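(* Let $Q$ be a quasifield with residue field $K$. The differential closure $\overline{Q}$ is minimal over $Q$ (that is, there is no differentially closed quasifield $D$ that is a differential subring of $\overline Q$ with $Q\subseteq D\subsetneq \overline{Q}$) if and only if the field $K$ is uncountable.
   Context: A differential ring is a commutative associative unital ring with a fixed finite nonempty set $\Delta$ of pairwise commuting derivations (the same $\Delta$ for all rings). $\Theta$ is the free commutative monoid generated by $\Delta$, acting as derivative operators. All rings have nonzero characteristic; homomorphisms are unital, and differential homomorphisms commute with $\Delta$. A quasifield is a nonzero differential ring of nonzero characteristic whose only differential ideals are $0$ and the whole ring. (It is known that a quasifield is a local ring of Krull dimension $0$, of prime characteristic $p$, with maximal ideal $\{x\mid x^p=0\}$.) Its residue field is the quotient by the maximal ideal. $Q\{y_1,\ldots,y_n\}$ is the differential polynomial ring (polynomial ring over $Q$ in the $\theta y_i$, $\theta\in\Theta$). $V(\mathfrak a)\subseteq Q^n$ is the set of common zeros of $\mathfrak a$, $I(X)$ the set of differential polynomials vanishing on $X\subseteq Q^n$, and $\mathfrak{rad}(\mathfrak a)=\{f\mid \theta f\text{ is nilpotent modulo }\mathfrak a\text{ for all }\theta\in\Theta\}$. A quasifield $Q$ is differentially closed if $\mathfrak{rad}(\mathfrak a)=I(V(\mathfrak a))$ for every $n$ and every differential ideal $\mathfrak a$ of $Q\{y_1,\ldots,y_n\}$. Hurwitz series ring: let $\Delta=\{\delta_1,\ldots,\delta_m\}$ and identify $\Theta$ with $\mathbb N^m$. For a commutative ring $A$, $\operatorname{H}A$ is the set of families $(a_\alpha)_{\alpha\in\mathbb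 N^m}$ of elements of $A$ with componentwise addition, multiplication $(ab)_\gamma=\sum_{\alpha+\beta=\gamma}\binom{\gamma}{\alpha}a_\alpha b_\beta$, and derivations $(\delta_i a)_\alpha=a_{\alpha+e_i}$. Every ring homomorphism $\varphi\colon B\to A$ from a differential ring $B$ lifts uniquely to a differential homomorphism $\Phi\colon B\to\operatorname{H}A$ (the Taylor homomorphism) whose composition with the free-term map $\operatorname{H}A\to A$ is $\varphi$. The differential closure of $Q$ is $\overline Q=\operatorname{H}L$, where $L$ is an algebraic closure of $K$ if $K$ is uncountable, and $L$ is an algebraic closure of $K(x_\alpha)_{\alpha\in\omega_1}$ (with the $x_\alpha$ algebraically independent over $K$ and $\omega_1$ the first uncountable ordinal) if $K$ is at most countable. $Q$ is a differential subring of $\overline Q$ via the Taylor homomorphism of the composite $Q\to K\to L$. *)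

(* Defs.v *)
From HB Require Import structures.
From mathcomp Require Import all_boot all_order all_algebra.
From mathcomp Require Import boolp classical_sets functions cardinality wochoice.
From mathcomp Require Import finmap monalg.
(* Imported after monalg so that 'X_{1..m}, U_(i) and mdeg refer to the
   multi-indices of mpoly. *)
From mathcomp Require Import mpoly.

From mathcomp Require Import ring.

Set Implicit Arguments.
Unset Strict Implicit.
Unset Printing Implicit Defensive.

Import GRing.Theory.
Local Open Scope classical_set_scope.
Local Open Scope ring_scope.

Lemma mnm_ind m (P : 'X_{1..m} -> Prop) :
  P 0%MM -> (forall g i, P g -> P (g + U_(i))%MM) -> forall g, P g.
Proof.
move=> P0 PS g; move: {2}(mdeg g) (leqnn (mdeg g)) => d.
elim: d g => [|d IH] g.
  by rewrite leqn0 mdeg_eq0 => /eqP->.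
move=> le_g; case: (eqVneq g 0%MM) => [->//|].
rewrite -mdeg_eq0 mdegE sum_nat_eq0 negb_forall => /existsP[i /= gi].
have le1 : (U_(i) <= g)%MM by rewrite lep1mP.
rewrite -(submK le1); apply: PS; apply: IH.
by move: le_g; rewrite -{1}(submK le1) mdegD mdeg1 addn1 ltnS.
Qed.

(* [m] is the number of derivations. *)
HB.mixin Record isDiffRing (m : nat) R of GRing.ComNzRing R := {
  der : 'I_m -> R -> R;
  derD : forall i, {morph der i : x y / x + y};
  derM : forall i x y, der i (x * y) = der i x * y + x * der i y;
  derC : forall i j x, der i (der j x) = der j (der i x)
}.

#[short(type="diffRingType")]
HB.structure Definition DiffRing m := {R of GRing.ComNzRing R & isDiffRing m R}.

Section DiffRingTheory.
Variables (m : nat) (R : diffRingType m).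
Implicit Types (x y : R) (I J : set R).

Lemma der0 i : der i (0 : R) = 0.
Proof. by apply: (addrI (der i (0 : R))); rewrite -derD !addr0. Qed.

Lemma der1 i : der i (1 : R) = 0.
Proof.
apply: (addrI (der i (1 : R))); rewrite addr0.
by rewrite -{3}[1]mulr1 derM mulr1 mul1r.
Qed.

(* The monoid of derivative operators is identified with the multi-indices. *)
Definition theta (a : 'X_{1..m}) x : R :=
  foldr (fun i => iter (a i) (der i)) x (enum 'I_m).

Lemma theta0 x : theta 0%MM x = x.
Proof.
by rewrite /theta; elim: (enum 'I_m) => //= i s ->; rewrite mnm0E.
Qed.

Lemma der_iterC i j k x : der i (iter k (der j) x) = iter k (der j) (der i x).
Proof. by elim: k => //= k <-; rewrite derC. Qed.

Lemma der_theta i a x : der i (theta a x) = theta a (der i x).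
Proof.
by rewrite /theta; elim: (enum 'I_m) => //= j s <-; rewrite der_iterC.
Qed.

Lemma thetaS i a x : theta (a + U_(i))%MM x = theta a (der i x).
Proof.
rewrite /theta; have := enum_uniq 'I_m; have := mem_enum 'I_m i.
elim: (enum 'I_m) x => //= j s IH x; rewrite inE.
have [-> _ /andP[js _]|ij /= is_ /andP[_ us]] := eqVneq i j; last first.
  by rewrite IH // mnmDE mnm1E (negbTE ij) addn0.
rewrite mnmDE mnm1E eqxx addn1 iterSr; congr (iter _ _ _).
elim: s js {IH} => [//|k s IH]; rewrite inE negb_or => /andP[jk js] /=.
by rewrite mnmDE mnm1E (negbTE jk) addn0 der_iterC IH.
Qed.

Lemma thetaD a : {morph theta a : x y / x + y}.
Proof.
elim/mnm_ind: a => [|a i IH] x y; first by rewrite !theta0.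
by rewrite !thetaS derD IH.
Qed.

Lemma theta_1 a : theta a 1 = (a == 0%MM)%:R.
Proof.
elim/mnm_ind: a => [|a i _]; first by rewrite theta0 eqxx.
rewrite thetaS der1 -mdeg_eq0 mdegD mdeg1 addn1.
by apply: (addrI (theta a 0)); rewrite -thetaD !addr0.
Qed.

Record diff_ideal I : Prop := DiffIdeal {
  diff_ideal0 : I 0;
  diff_idealD : forall x y, I x -> I y -> I (x + y);
  diff_idealM : forall x y, I y -> I (x * y);
  diff_ideal_der : forall i x, I x -> I (der i x)
}.

(* That R is nonzero is part of its comNzRingType structure. *)
Definition quasifield : Prop :=
  (exists2 n : nat, (0 < n)%N & n%:R = 0 :> R) /\
  (forall I, diff_ideal I -> I = [set 0] \/ I = setT).

Definition drad I : set R := [set f | forall a, exists k, I (theta a f ^+ k)].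

Record diff_subring (S : set R) : Prop := DiffSubring {
  diff_subring1 : S 1;
  diff_subringB : forall x y, S x -> S y -> S (x - y);
  diff_subringM : forall x y, S x -> S y -> S (x * y);
  diff_subring_der : forall i x, S x -> S (der i x)
}.

End DiffRingTheory.

Arguments quasifield {m} R.

Definition diff_morphism m (A B : diffRingType m) (f : A -> B) : Prop :=
  forall i x, f (der i x) = der i (f x).

Section SubDiffRing.
Variables (m : nat) (R : diffRingType m) (S : set R) (hS : diff_subring S).

Definition sub_pred of diff_subring S : {pred R} := fun x => `[< S x >].

Fact sub_subring_closed : subring_closed (sub_pred hS).
Proof.
split; first exact/asboolP/(diff_subring1 hS).
  by move=> x y /asboolP Sx /asboolP Sy; apply/asboolP/(diff_subringB hS).
by move=> x y /asboolP Sx /asboolP Sy; apply/asboolP/(diff_subringM hS).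
Qed.

HB.instance Definition _ :=
  GRing.isSubringClosed.Build R (sub_pred hS) sub_subring_closed.

Record subDiffRing : predArgType :=
  SubDiffRing { sub_val : R; _ : sub_val \in sub_pred hS }.

HB.instance Definition _ := [isSub for sub_val].
HB.instance Definition _ := [Choice of subDiffRing by <:].
HB.instance Definition _ := [SubChoice_isSubComNzRing of subDiffRing by <:].

Fact sub_der_subproof i (x : subDiffRing) : der i (val x) \in sub_pred hS.
Proof. by case: x => x /= /asboolP Sx; apply/asboolP/(diff_subring_der hS). Qed.

Definition sub_der i (x : subDiffRing) : subDiffRing :=
  SubDiffRing (sub_der_subproof i x).

Fact sub_derD i : {morph sub_der i : x y / x + y}.
Proof. by move=> x y; apply: val_inj; rewrite /= derD. Qed.
Fact sub_derM i x y : sub_der i (x * y) = sub_der i x * y + x * sub_der i y.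
Proof. by apply: val_inj; rewrite /= derM. Qed.
Fact sub_derC i j x : sub_der i (sub_der j x) = sub_der j (sub_der i x).
Proof. by apply: val_inj; rewrite /= derC. Qed.

HB.instance Definition _ :=
  isDiffRing.Build m subDiffRing sub_derD sub_derM sub_derC.

End SubDiffRing.

Definition mon_eval (I : choiceType) (S : comNzRingType) (x : I -> S)
  (k : {cmonom I}) : S := \prod_(v <- finsupp k) x v ^+ k v.

(* Evaluation of a polynomial in arbitrarily many variables, the coefficients
   being mapped by [f] and the variables by [x]. *)
Definition poly_eval (I : choiceType) (R S : comNzRingType) (f : R -> S)
  (x : I -> S) : {malg R[{cmonom I}]} -> S := monalg.mmap f (mon_eval x).

Section Leibniz.
Variable T : comNzRingType.

Lemma sum_leibniz (I : Type) (s : seq I) (F G H : I -> T) (a b : T) :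
    (forall v, F v = G v * a + b * H v) ->
  \sum_(v <- s) F v = (\sum_(v <- s) G v) * a + b * (\sum_(v <- s) H v).
Proof.
by move=> E; rewrite mulr_suml mulr_sumr -big_split /=; apply: eq_bigr.
Qed.

Lemma mul_leibniz (x y z a b u : T) : x = y * a + b * z ->
  x * u = y * u * a + b * (z * u).
Proof. by move=> ->; rewrite mulrDl mulrAC mulrA. Qed.

Lemma leibnizD (D : T -> T) (f1 f2 g : T) : {morph D : x y / x + y} ->
    D (f1 * g) = D f1 * g + f1 * D g -> D (f2 * g) = D f2 * g + f2 * D g ->
  D ((f1 + f2) * g) = D (f1 + f2) * g + (f1 + f2) * D g.
Proof. by move=> DD E1 E2; rewrite mulrDl !DD E1 E2; ring. Qed.

Lemma leibnizDr (D : T -> T) (f g1 g2 : T) : {morph D : x y / x + y} ->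
    D (f * g1) = D f * g1 + f * D g1 -> D (f * g2) = D f * g2 + f * D g2 ->
  D (f * (g1 + g2)) = D f * (g1 + g2) + f * D (g1 + g2).
Proof. by move=> DD E1 E2; rewrite mulrDr !DD E1 E2; ring. Qed.

Lemma leibnizC (D1 D2 : T -> T) (f g : T) :
    {morph D1 : x y / x + y} -> {morph D2 : x y / x + y} ->
    (forall x y, D1 (x * y) = D1 x * y + x * D1 y) ->
    (forall x y, D2 (x * y) = D2 x * y + x * D2 y) ->
    D1 (D2 f) = D2 (D1 f) -> D1 (D2 g) = D2 (D1 g) ->
  D1 (D2 (f * g)) = D2 (D1 (f * g)).
Proof.
move=> D1D D2D D1M D2M Ef Eg.
by rewrite D1M D2M D1D D2D !D1M !D2M Ef Eg; ring.
Qed.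

Lemma leibnizU (c1 c2 d1 d2 k1 k2 e1 e2 : T) :
  (d1 * c2 + c1 * d2) * (k1 * k2) + c1 * c2 * (e1 * k2 + k1 * e2) =
  (d1 * k1 + c1 * e1) * (c2 * k2) + c1 * k1 * (d2 * k2 + c2 * e2).
Proof. by ring. Qed.

End Leibniz.

(* The derivation of a polynomial ring which extends the derivation [d] of the
   coefficient ring and maps each variable [v] to [e v]. *)
Section PolyDerivation.
Variables (I : choiceType) (R : comNzRingType).
Local Notation P := {malg R[{cmonom I}]}.

Section Def.
Variables (d : R -> R) (e : I -> P).

Definition mon_der (k : {cmonom I}) : P :=
  \sum_(v <- finsupp k) (<< (k v)%:R *g divcm k (ucm v) >> * e v).

Definition poly_der (f : P) : P :=
  \sum_(k <- monalg.msupp f)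
     (<< d (monalg.mcoeff k f) *g k >> +
      malgC (monalg.mcoeff k f) * mon_der k).

Lemma mon_derEw (D : {fset I}) (k : {cmonom I}) : (finsupp k `<=` D)%fset ->
  mon_der k = \sum_(v <- D) (<< (k v)%:R *g divcm k (ucm v) >> * e v).
Proof.
move=> le; rewrite /mon_der (big_fset_incl _ le) => //= v _ vk.
have -> : k v = 0%N by apply: fsfun_dflt.
by rewrite mulr0n monalgU0 mul0r.
Qed.

Lemma malg_mulUU (c1 c2 : R) (k1 k2 : {cmonom I}) :
  << c1 *g k1 >> * << c2 *g k2 >> = << c1 * c2 *g (mmul k1 k2) >> :> P.
Proof. by rewrite malgM_def fgmulUU. Qed.

Lemma mon_derM k1 k2 :
  mon_der (mmul k1 k2) = mon_der k1 * << k2 >> + << k1 >> * mon_der k2.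
Proof.
rewrite (mon_derEw (D := (finsupp k1 `|` finsupp k2)%fset)); last first.
  by rewrite mdomD.
rewrite (mon_derEw (fsubsetUl (finsupp k1) (finsupp k2))).
rewrite (mon_derEw (fsubsetUr (finsupp k1) (finsupp k2))).
apply: sum_leibniz => v; apply: mul_leibniz.
rewrite [X in _ = X + _]malg_mulUU [X in _ = _ + X]malg_mulUU.
rewrite [X in << X *g _ >> + _]mulr1 [X in _ + << X *g _ >>]mul1r.
have C : forall (k1 k2 : {cmonom I}), k1 v != 0%N ->
    mmul (divcm k1 (ucm v)) k2 = divcm (mmul k1 k2) (ucm v).
  move=> l1 l2 nz; apply/eqP/cmP => w; rewrite !(divcmE, mulcmE, ucmE).
  by case: eqVneq => [<-|_]; rewrite ?subn0 // addnBAC // lt0n.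
have -> : << (k1 v)%:R *g mmul (divcm k1 (ucm v)) k2 >> =
          << (k1 v)%:R *g divcm (mmul k1 k2) (ucm v) >> :> P.
  by case: (eqVneq (k1 v) 0%N) => [->|/C->//]; rewrite !mulr0n !monalgU0.
have -> : << (k2 v)%:R *g mmul k1 (divcm k2 (ucm v)) >> =
          << (k2 v)%:R *g divcm (mmul k1 k2) (ucm v) >> :> P.
  case: (eqVneq (k2 v) 0%N) => [->|/C k2P]; first by rewrite !mulr0n !monalgU0.
  by rewrite mulmC k2P mulmC.
by rewrite -monalgUD -natrD mulcmE.
Qed.

Lemma malg_ind (Q : P -> Prop) :
  Q 0 -> (forall c k, Q << c *g k >>) -> (forall f g, Q f -> Q g -> Q (f + g)) ->
  forall f, Q f.
Proof.
by move=> Q0 QU QD f; rewrite [f]monalgE; elim/big_ind: _ => // k _; apply: QU.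
Qed.

Hypothesis dD : {morph d : x y / x + y}.
Hypothesis dM : forall x y, d (x * y) = d x * y + x * d y.

Let d0 : d 0 = 0.
Proof. by apply: (addrI (d 0)); rewrite -dD !addr0. Qed.

Let d1 : d 1 = 0.
Proof.
by apply: (addrI (d 1)); rewrite addr0 -{3}[1]mulr1 dM mulr1 mul1r.
Qed.

Lemma poly_derEw (D : {fset {cmonom I}}) f : (monalg.msupp f `<=` D)%fset ->
  poly_der f = \sum_(k <- D)
     (<< d (monalg.mcoeff k f) *g k >> + malgC (monalg.mcoeff k f) * mon_der k).
Proof.
move=> le; rewrite /poly_der (big_fset_incl _ le) => //= k _ kf.
by rewrite (mcoeff_outdom kf) d0 !monalgU0 mul0r addr0.
Qed.

Lemma poly_derD : {morph poly_der : f g / f + g}.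
Proof.
move=> f g; rewrite (poly_derEw (monalg.msuppD_le f g)).
rewrite (poly_derEw (fsubsetUl _ (monalg.msupp g))).
rewrite (poly_derEw (fsubsetUr (monalg.msupp f) _)) -big_split /=.
apply: eq_bigr => k _; rewrite monalg.mcoeffD dD !monalgUD mulrDl.
by rewrite addrACA.
Qed.

Lemma poly_derU c k :
  poly_der << c *g k >> = << d c *g k >> + malgC c * mon_der k.
Proof. by rewrite (poly_derEw msuppU_le) big_seq_fset1 mcoeffUU. Qed.

Lemma poly_der0 : poly_der 0 = 0.
Proof. by rewrite /poly_der monalg.msupp0 big_seq_fset0. Qed.

Let monalgUE c k : << c *g k >> = malgC c * << k >> :> P.
Proof. by rewrite malg_mulUU mulr1 mul1m. Qed.

Let malgCD (a b : R) : malgC (a + b) = malgC a + malgC b :> P.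
Proof. exact: monalgUD. Qed.

Let malgCM (a b : R) : malgC (a * b) = malgC a * malgC b :> P.
Proof. by rewrite malg_mulUU mulm1. Qed.

Lemma poly_derM f g : poly_der (f * g) = poly_der f * g + f * poly_der g.
Proof.
elim/malg_ind: f => [|c1 k1|f1 f2]; last exact: leibnizD poly_derD.
  by rewrite !mul0r poly_der0 mul0r addr0.
elim/malg_ind: g => [|c2 k2|g1 g2 IH1 IH2].
- by rewrite !mulr0 poly_der0 mulr0 addr0.
- have k12 : << mmul k1 k2 >> = << k1 >> * << k2 >> :> P.
    by rewrite [RHS]malg_mulUU [X in _ = << X *g _ >>]mulr1.
  have D1 : poly_der << c1 *g k1 >> =
      malgC (d c1) * << k1 >> + malgC c1 * mon_der k1.
    exact: etrans (poly_derU c1 k1) (congr1 (+%R^~ _) (monalgUE (d c1) k1)).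
  have D2 : poly_der << c2 *g k2 >> =
      malgC (d c2) * << k2 >> + malgC c2 * mon_der k2.
    exact: etrans (poly_derU c2 k2) (congr1 (+%R^~ _) (monalgUE (d c2) k2)).
  have D12 : poly_der (<< c1 *g k1 >> * << c2 *g k2 >>) =
      malgC (d (c1 * c2)) * << mmul k1 k2 >> +
      malgC (c1 * c2) * mon_der (mmul k1 k2).
    apply: etrans (congr1 poly_der (malg_mulUU c1 c2 k1 k2)) _.
    exact: etrans (poly_derU _ _) (congr1 (+%R^~ _) (monalgUE _ _)).
  have dE : malgC (d (c1 * c2)) =
      malgC (d c1) * malgC c2 + malgC c1 * malgC (d c2) :> P.
    apply: etrans (congr1 malgC (dM c1 c2)) _; apply: etrans (malgCD _ _) _.
    exact: (congr2 +%R (malgCM _ _) (malgCM _ _)).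
  apply: etrans D12 _; apply: etrans (congr2 +%R (congr2 *%R dE k12)
    (congr2 *%R (malgCM c1 c2) (mon_derM k1 k2))) _.
  apply: etrans (leibnizU _ _ _ _ _ _ _ _) (esym _).
  exact: (congr2 +%R (congr2 *%R D1 (monalgUE c2 k2))
                     (congr2 *%R (monalgUE c1 k1) D2)).
- exact: leibnizDr poly_derD IH1 IH2.
Qed.

Lemma poly_derC c : poly_der (malgC c) = malgC (d c).
Proof.
apply: etrans (poly_derU _ _) _.
by rewrite /mon_der mdom1 big_seq_fset0 mulr0 addr0.
Qed.

Lemma poly_derX v : poly_der << ucm v >> = e v.
Proof.
apply: etrans (poly_derU _ _) _; rewrite d1 monalgU0 add0r.
rewrite /mon_der mdomU big_seq_fset1 ucmE eqxx.
have -> : divcm (ucm v) (ucm v) = mone.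
  by apply/eqP/cmP => w; rewrite divcmE subnn cm1.
by rewrite !mul1r.
Qed.

End Def.

Lemma cmonom_ind (Q : {cmonom I} -> Prop) :
  Q mone -> (forall v k, Q k -> Q (mmul (ucm v) k)) -> forall k, Q k.
Proof.
move=> Q1 QS k; move: {2}(monalg.mdeg k) (leqnn (monalg.mdeg k)) => n.
elim: n k => [|n IH] k.
  by rewrite leqn0 monalg.mdeg_eq0 => /eqP->.
move=> le_k; have [->//|/eqP nz] := eqVneq k mone.
have [v kv] : exists v, k v != 0%N.
  apply: contra_notP nz => nex; apply/eqP/cmP => v; rewrite cm1.
  by apply/eqP; apply: contra_notT nex => kv; exists v.
have kE : k = mmul (ucm v) (divcm k (ucm v)).
  apply/eqP/cmP => w; rewrite mulcmE divcmE ucmE.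
  by case: eqVneq => [<-|_]; rewrite ?subn0 // subnKC // lt0n.
rewrite kE; apply: QS; apply: IH.
by move: le_k; rewrite {1}kE mdegM monalg.mdegU add1n ltnS.
Qed.

Lemma poly_der_comm (d1 d2 : R -> R) (e1 e2 : I -> P) :
    {morph d1 : x y / x + y} -> {morph d2 : x y / x + y} ->
    (forall x y, d1 (x * y) = d1 x * y + x * d1 y) ->
    (forall x y, d2 (x * y) = d2 x * y + x * d2 y) ->
    (forall x, d1 (d2 x) = d2 (d1 x)) ->
    (forall v, poly_der d1 e1 (e2 v) = poly_der d2 e2 (e1 v)) ->
  forall f, poly_der d1 e1 (poly_der d2 e2 f) = poly_der d2 e2 (poly_der d1 e1 f).
Proof.
move=> d1D d2D d1M d2M dC eC.
have D1D := poly_derD e1 d1D; have D2D := poly_derD e2 d2D.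
have D1M := poly_derM e1 d1D d1M; have D2M := poly_derM e2 d2D d2M.
have C1 := poly_derC e1 d1D; have C2 := poly_derC e2 d2D.
have X1 := poly_derX e1 d1D d1M; have X2 := poly_derX e2 d2D d2M.
have Z1 := poly_der0 d1 e1; have Z2 := poly_der0 d2 e2.
set D1 := poly_der d1 e1 in D1D D1M C1 X1 Z1 eC *.
set D2 := poly_der d2 e2 in D2D D2M C2 X2 Z2 eC *.
move: D1 D2 => D1 D2 in D1D D1M C1 X1 Z1 eC D2D D2M C2 X2 Z2 *.
elim/malg_ind => [|c k|f g Ef Eg]; first by rewrite Z1 Z2 Z1.
- elim/cmonom_ind: k => [|v k IH].
    apply: etrans (congr1 D1 (C2 c)) _; apply: etrans (C1 _) _.
    apply: etrans (congr1 malgC (dC c)) _; apply: esym.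
    exact: etrans (congr1 D2 (C1 c)) (C2 _).
  have -> : << c *g mmul (ucm v) k >> = << ucm v >> * << c *g k >> :> P.
    by rewrite [RHS]malg_mulUU [X in _ = << X *g _ >>]mul1r.
  apply: leibnizC D1D D2D D1M D2M _ IH.
  apply: etrans (congr1 D1 (X2 v)) _; apply: etrans (eC v) _.
  by rewrite [D1 << _ >>]X1.
- by rewrite D1D D2D D1D D2D Ef Eg.
Qed.

End PolyDerivation.

(* The differential polynomial ring R{y_1, ..., y_n}: the variable (i, a)
   stands for the derivative theta^a y_i. *)
Section DiffPoly.
Variables (m : nat) (R : diffRingType m) (n : nat).

Definition diffpoly : predArgType := {malg R[{cmonom ('I_n * 'X_{1..m})%type}]}.

HB.instance Definition _ := GRing.ComNzRing.on diffpoly.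

Definition var_der (j : 'I_m) (v : ('I_n * 'X_{1..m})%type) :
    {malg R[{cmonom ('I_n * 'X_{1..m})%type}]} :=
  << ucm (v.1, (v.2 + U_(j))%MM) >>.

Definition diffpoly_der (j : 'I_m) (f : diffpoly) : diffpoly :=
  poly_der (der j) (var_der j) f.

Fact diffpoly_derD j : {morph diffpoly_der j : x y / x + y}.
Proof. exact/poly_derD/derD. Qed.

Fact diffpoly_derM j x y :
  diffpoly_der j (x * y) = diffpoly_der j x * y + x * diffpoly_der j y.
Proof. exact/poly_derM/derM/derD. Qed.

Fact diffpoly_derC i j x :
  diffpoly_der i (diffpoly_der j x) = diffpoly_der j (diffpoly_der i x).
Proof.
apply: poly_der_comm; do ?[exact: derD | exact: derM | exact: derC].
move=> v; rewrite /var_der !poly_derX; do ?[exact: derD | exact: derM].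
by rewrite /var_der /= -!addmA [(U_(i) + _)%MM]addmC.
Qed.

HB.instance Definition _ :=
  isDiffRing.Build m diffpoly diffpoly_derD diffpoly_derM diffpoly_derC.

Definition diff_eval (y : 'I_n -> R) (f : diffpoly) : R :=
  poly_eval id (fun v => theta v.2 (y v.1)) f.

Definition zero_set (I : set diffpoly) : set ('I_n -> R) :=
  [set y | forall f, I f -> diff_eval y f = 0].

Definition vanishing_ideal (X : set ('I_n -> R)) : set diffpoly :=
  [set f | forall y, X y -> diff_eval y f = 0].

End DiffPoly.

Definition diff_closed m (R : diffRingType m) : Prop :=
  forall (n : nat) (I : set (diffpoly R n)), diff_ideal I ->
    drad I = vanishing_ideal (zero_set I).

Section Hurwitz.
Variables (m : nat) (A : comNzRingType).

Record hurwitz : predArgType := Hurwitz { hcoef : 'X_{1..m} -> A }.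

HB.instance Definition _ := [isNew for hcoef].
HB.instance Definition _ := [Choice of hurwitz by <:].

Implicit Types a b c : hurwitz.

Lemma hurwitzP a b : (forall g, hcoef a g = hcoef b g) -> a = b.
Proof. by case: a b => [a] [b] /= ab; congr Hurwitz; apply/funext. Qed.

Definition hadd a b := Hurwitz (fun g => hcoef a g + hcoef b g).
Definition hopp a := Hurwitz (fun g => - hcoef a g).
Definition hzero := Hurwitz (fun=> 0).
Definition hone := Hurwitz (fun g => (g == 0%MM)%:R).

Definition mbin (g a : 'X_{1..m}) : nat := \prod_(i < m) 'C(g i, a i).

Lemma mbin_eq0 g x : ~~ (x <= g)%MM -> mbin g x = 0%N.
Proof.
rewrite negb_forall => /existsP[i]; rewrite -ltnNge => gi.
by rewrite /mbin (bigD1 i) //= bin_small.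
Qed.

(* Since x <= g implies mdeg x <= mdeg g, the degree bound only makes the index
   type finite: the sum is over all x, y with x + y = g. *)
Definition hmul a b := Hurwitz (fun g =>
  \sum_(x : 'X_{1..m < (mdeg g).+1} | (x <= g)%MM)
    (mbin g x)%:R * hcoef a x * hcoef b (g - x)%MM).

Definition hder (i : 'I_m) a := Hurwitz (fun g => hcoef a (g + U_(i))%MM).

Fact haddA : associative hadd.
Proof. by move=> a b c; apply: hurwitzP => g /=; rewrite addrA. Qed.
Fact haddC : commutative hadd.
Proof. by move=> a b; apply: hurwitzP => g /=; rewrite addrC. Qed.
Fact hadd0 : left_id hzero hadd.
Proof. by move=> a; apply: hurwitzP => g /=; rewrite add0r. Qed.
Fact haddN : left_inverse hzero hopp hadd.
Proof. by move=> a; apply: hurwitzP => g /=; rewrite addNr. Qed.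

HB.instance Definition _ := GRing.isZmodule.Build hurwitz haddA haddC hadd0 haddN.

Lemma hcoefD a b g : hcoef (a + b) g = hcoef a g + hcoef b g.
Proof. by []. Qed.

Lemma hmulE a b (g : 'X_{1..m}) (s : seq 'X_{1..m}) :
    uniq s -> (forall x, (x <= g)%MM -> x \in s) ->
  hcoef (hmul a b) g =
  \sum_(x <- s) (mbin g x)%:R * hcoef a x * hcoef b (g - x)%MM.
Proof.
move=> us gs; rewrite /= [RHS](bigID (fun x => (x <= g)%MM)) /=.
rewrite [X in _ = _ + X]big1 ?addr0; last first.
  by move=> x xg; rewrite mbin_eq0 // !mul0r.
rewrite -big_filter -[RHS]big_filter -(big_map (@bmnm _ _) predT
  (fun x => (mbin g x)%:R * hcoef a x * hcoef b (g - x)%MM)).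
apply: perm_big; apply: uniq_perm.
- rewrite map_inj_uniq; last exact: val_inj.
  by rewrite filter_uniq // index_enum_uniq.
- exact: filter_uniq.
move=> x; rewrite mem_filter; apply/mapP/andP => [[y yP ->]|[xg xs]].
  by move: yP; rewrite mem_filter => /andP[yg _]; split => //; apply: gs.
have dx : (mdeg x < (mdeg g).+1)%N.
  rewrite ltnS !mdegE; apply: leq_sum => i _; exact: (mnm_lepP xg).
by exists (BMultinom dx) => //; rewrite mem_filter xg mem_index_enum.
Qed.

Definition mlow (g : 'X_{1..m}) : seq 'X_{1..m} :=
  [seq bmnm x | x <- index_enum 'X_{1..m < (mdeg g).+1} & (bmnm x <= g)%MM].

Lemma mlow_uniq g : uniq (mlow g).
Proof.
rewrite map_inj_uniq; last exact: val_inj.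
by rewrite filter_uniq // index_enum_uniq.
Qed.

Lemma mem_mlow g x : (x \in mlow g) = (x <= g)%MM.
Proof.
apply/mapP/idP => [[y yP ->]|xg].
  by move: yP; rewrite mem_filter => /andP[].
have dx : (mdeg x < (mdeg g).+1)%N.
  rewrite ltnS !mdegE; apply: leq_sum => i _; exact: (mnm_lepP xg).
by exists (BMultinom dx) => //; rewrite mem_filter xg mem_index_enum.
Qed.

Lemma mbinS g i x : mbin (g + U_(i))%MM x =
  (mbin g x + (x i != 0) * mbin g (x - U_(i))%MM)%N.
Proof.
have H (h y : 'X_{1..m}) :
    mbin h y = ('C(h i, y i) * \prod_(j < m | j != i) 'C(h j, y j))%N.
  by rewrite /mbin (bigD1 i).
rewrite !H mnmDE mnmBE mnm1E eqxx addn1.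
have E1 : \prod_(j < m | j != i) 'C((g + U_(i))%MM j, x j) =
          \prod_(j < m | j != i) 'C(g j, x j).
  by apply: eq_bigr => j /negbTE ji; rewrite mnmDE mnm1E eq_sym ji addn0.
have E2 : \prod_(j < m | j != i) 'C(g j, (x - U_(i))%MM j) =
          \prod_(j < m | j != i) 'C(g j, x j).
  by apply: eq_bigr => j /negbTE ji; rewrite mnmBE mnm1E eq_sym ji subn0.
rewrite E1 E2; case: (x i) => [|k]; first by rewrite !bin0 mul0n addn0.
by rewrite binS subn1 mul1n mulnDl.
Qed.

(* The derivations satisfy the Leibniz rule, and the free term is
   multiplicative: these facts characterize the product, and all ring axioms
   follow from them by induction on the multi-index. *)
Fact hderM i a b : hder i (hmul a b) = hmul (hder i a) b + hmul a (hder i b).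
Proof.
apply: hurwitzP => g; rewrite hcoefD.
pose s := mlow (g + U_(i))%MM.
have us : uniq s by apply: mlow_uniq.
have gs x : (x <= g + U_(i))%MM -> x \in s by rewrite mem_mlow.
rewrite [LHS](hmulE a b us gs).
rewrite (@hmulE a _ g s) // => [|x xg]; last first.
  by apply: gs; apply: lepm_trans xg (lem_addr _ _).
rewrite (hmulE _ _ (mlow_uniq g)) => [|x]; last by rewrite mem_mlow.
under eq_bigr do rewrite mbinS natrD !mulrDl.
rewrite big_split /= addrC; congr (_ + _); last first.
  apply: eq_bigr => x _; case xg: (x <= g)%MM; last by rewrite mbin_eq0 ?xg ?mul0r.
  congr (_ * hcoef b _); apply/mnmP => j; rewrite !(mnmBE, mnmDE).
  by rewrite addnBAC //; apply/mnm_lepP.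
rewrite (bigID (fun x : 'X_{1..m} => x i != 0%N)) /= [X in _ + X]big1 ?addr0.
  2: by move=> x; rewrite negbK => /eqP->; rewrite mul0n !mul0r.
rewrite -big_filter (perm_big [seq (x + U_(i))%MM | x <- mlow g]) /=.
  rewrite big_map; apply: eq_bigr => x _.
  rewrite mnmDE mnm1E eqxx addn1 mul1n addmK; congr (_ * hcoef b _).
  by rewrite [(x + _)%MM]addmC -submDA addmK.
apply: uniq_perm; first exact: filter_uniq.
  by rewrite map_inj_uniq ?mlow_uniq //; apply: addIm.
move=> x; rewrite mem_filter mem_mlow; apply/andP/mapP => [[xi xg]|[y yg ->]].
  have xi' : (U_(i) <= x)%MM by rewrite lep1mP.
  exists (x - U_(i))%MM; last by rewrite submK.
  rewrite mem_mlow; apply/mnm_lepP => j; move/mnm_lepP/(_ j): xg.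
  by rewrite mnmBE mnmDE leq_subLR addnC.
move: yg; rewrite mem_mlow => yg; split; first by rewrite mnmDE mnm1E eqxx addn1.
apply/mnm_lepP => j; rewrite !mnmDE leq_add2r; exact: (mnm_lepP yg).
Qed.

Fact hmul_coef0 a b : hcoef (hmul a b) 0%MM = hcoef a 0%MM * hcoef b 0%MM.
Proof.
rewrite (@hmulE _ _ _ [:: 0%MM]) // => [|x /mnm_lepP x0]; last first.
  rewrite inE; apply/eqP/mnmP => i; apply/eqP.
  by have := x0 i; rewrite mnm0E leqn0.
rewrite big_seq1 subm0 /mbin big1 ?mul1r // => i _; by rewrite mnm0E.
Qed.

Fact hderD i : {morph hder i : a b / a + b}.
Proof. by move=> a b; apply: hurwitzP. Qed.

Fact hderC i j a : hder i (hder j a) = hder j (hder i a).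
Proof.
by apply: hurwitzP => g /=; rewrite -!addmA [(U_(i) + _)%MM]addmC.
Qed.

Fact hmulDl : left_distributive hmul +%R.
Proof.
move=> a b c; apply: hurwitzP => g; rewrite hcoefD /= -big_split /=.
by apply: eq_bigr => x _; rewrite mulrDr mulrDl.
Qed.

Fact hmulDr : right_distributive hmul +%R.
Proof.
move=> a b c; apply: hurwitzP => g; rewrite hcoefD /= -big_split /=.
by apply: eq_bigr => x _; rewrite mulrDr.
Qed.

Fact hmulC : commutative hmul.
Proof.
move=> a b; apply: hurwitzP => g.
elim/mnm_ind: g a b => [|g i IH] a b; first by rewrite !hmul_coef0 mulrC.
rewrite -[LHS]/(hcoef (hder i _) g) -[RHS]/(hcoef (hder i _) g).
by rewrite !hderM !hcoefD IH addrC [in X in X + _]IH.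
Qed.

Fact hmulA : associative hmul.
Proof.
move=> a b c; apply: hurwitzP => g.
elim/mnm_ind: g a b c => [|g i IH] a b c; first by rewrite !hmul_coef0 mulrA.
rewrite -[LHS]/(hcoef (hder i _) g) -[RHS]/(hcoef (hder i _) g).
by rewrite !hderM hmulDr hmulDl !hcoefD !IH addrA.
Qed.

Fact hder_one i : hder i hone = 0.
Proof.
by apply: hurwitzP => g /=; rewrite -mdeg_eq0 mdegD mdeg1 addn1.
Qed.

Fact hmul1 : left_id hone hmul.
Proof.
move=> a; apply: hurwitzP => g.
elim/mnm_ind: g a => [|g i IH] a; first by rewrite hmul_coef0 /= eqxx mul1r.
rewrite -[LHS]/(hcoef (hder i _) g) hderM hder_one hcoefD IH.
rewrite (_ : hmul 0 a = 0) ?add0r //.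
by apply: hurwitzP => x /=; rewrite big1 // => y _; rewrite mulr0 mul0r.
Qed.

Fact hone_neq0 : hone != 0.
Proof.
apply/eqP => /(congr1 (fun a => hcoef a 0%MM)) /= /eqP.
by rewrite eqxx oner_eq0.
Qed.

HB.instance Definition _ := GRing.Zmodule_isComNzRing.Build hurwitz
  hmulA hmulC hmul1 hmulDl hone_neq0.
HB.instance Definition _ := isDiffRing.Build m hurwitz hderD hderM hderC.

End Hurwitz.

Section Taylor.
Variables (m : nat) (B : diffRingType m) (A : comNzRingType).
Variable phi : {rmorphism B -> A}.

Definition taylor (b : B) : hurwitz m A := Hurwitz (fun g => phi (theta g b)).

Lemma taylor_der : diff_morphism taylor.
Proof. by move=> i b; apply: hurwitzP => g /=; rewrite thetaS. Qed.

Lemma taylor_free b : hcoef (taylor b) 0%MM = phi b.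
Proof. by rewrite /= theta0. Qed.

Lemma taylor_unique (Phi : B -> hurwitz m A) : diff_morphism Phi ->
  (forall b, hcoef (Phi b) 0%MM = phi b) -> Phi =1 taylor.
Proof.
move=> PhiD Phi0 b; apply: hurwitzP => g.
elim/mnm_ind: g b => [|g i IH] b; first by rewrite Phi0 taylor_free.
by rewrite -[LHS]/(hcoef (der i _) g) -PhiD IH /= thetaS.
Qed.

Fact taylor_zmod_morphism : zmod_morphism taylor.
Proof.
move=> x y; apply: hurwitzP => g /=.
rewrite -[in RHS]rmorphB; congr (phi _); apply: (addIr (theta g y)).
by rewrite -thetaD !subrK.
Qed.

Fact taylor_monoid_morphism : monoid_morphism taylor.
Proof.
split=> [|x y]; apply: hurwitzP => g.
  by rewrite /= theta_1 rmorph_nat.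
elim/mnm_ind: g x y => [|g i IH] x y.
  by rewrite [RHS]hmul_coef0 !taylor_free rmorphM.
rewrite -[RHS]/(hcoef (der i _) g) derM -!taylor_der hcoefD -!IH.
by rewrite -hcoefD /= thetaS derM thetaD rmorphD.
Qed.

HB.instance Definition _ :=
  GRing.isZmodMorphism.Build B (hurwitz m A) taylor taylor_zmod_morphism.
HB.instance Definition _ :=
  GRing.isMonoidMorphism.Build B (hurwitz m A) taylor taylor_monoid_morphism.

End Taylor.

Definition ideal (R : comNzRingType) (I : set R) : Prop :=
  [/\ I 0, forall x y, I x -> I y -> I (x + y) & forall x y, I y -> I (x * y)].

Definition maximal_ideal (R : comNzRingType) (I : set R) : Prop :=
  [/\ ideal I, I `<` setT &
      forall J : set R, ideal J -> I `<=` J -> J = I \/ J = setT].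

(* [K], with the projection [pi], is the quotient of [R] by a maximal ideal.
   Quasifields being local rings, that ideal is the only maximal one. *)
Definition residue_field (R : comNzRingType) (K : fieldType)
    (pi : {rmorphism R -> K}) : Prop :=
  maximal_ideal (pi @^-1` [set 0]) /\ (forall z, exists x, pi x = z).

Definition algebraic_closure (F : fieldType) (L : closedFieldType)
    (j : {rmorphism F -> L}) : Prop :=
  forall z, algebraicOver j z.

(* [M] is the field of rational functions over [K] in the variables [x w]. *)
Definition rational_function_field (K M : fieldType) (i : {rmorphism K -> M})
    (W : choiceType) (x : W -> M) : Prop :=
  injective (poly_eval i x) /\
  (forall z, exists f g, poly_eval i x g != 0 /\
     z = poly_eval i x f / poly_eval i x g).

(* An uncountable well-ordered set all of whose initial segments are countable
   has order type omega_1. *)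
Definition omega1_order (W : choiceType) (le : rel W) : Prop :=
  [/\ well_order le, ~ countable [set: W] &
      forall w, countable [set v | le v w]].

(* [L] is the field of constants over which the differential closure of a
   quasifield with residue field [K] is built. *)
Definition closure_field (K : fieldType) (L : closedFieldType)
    (iota : {rmorphism K -> L}) : Prop :=
  (~ countable [set: K] -> algebraic_closure iota) /\
  (countable [set: K] ->
    exists (W : choiceType) (le : rel W) (M : fieldType)
           (i : {rmorphism K -> M}) (x : W -> M) (j : {rmorphism M -> L}),
      [/\ omega1_order le, rational_function_field i x, algebraic_closure j &
          forall z, iota z = j (i z)]).

(* With [L] a closure field of the residue field of [Q], this embeds [Q] into
   its differential closure [hurwitz m L]. *)
Definition closure_embedding m (Q : diffRingType m) (K : fieldType)
    (L : closedFieldType) (pi : {rmorphism Q -> K})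
    (iota : {rmorphism K -> L}) : Q -> hurwitz m L :=
  taylor (iota \o pi).

(* [S] is the image of the base quasifield in [C]. *)
Definition minimal_over m (C : diffRingType m) (S : set C) : Prop :=
  ~ exists (D : set C) (hD : diff_subring D),
      [/\ quasifield (subDiffRing hD), diff_closed (subDiffRing hD),
          S `<=` D & D `<` setT].

(* Main.v *)
(* Let D be a differentially closed differential subring of H L containing Q,
   with L algebraic over K, and let h be in H L. The kernel of D{y} -> H L,
   y |-> h, is a proper differential ideal, hence has a zero d in D. If a
   polynomial over D has free-term image vanishing at the free term of theta h,
   then its p-th power at theta y is in the kernel; so the free term of theta d
   is a root of every polynomial over the residue field of D which vanishes at
   the free term of theta h. Dividing by a linear factor, the two free terms
   coincide, h = d, and D = H L.

   If K is countable, dropping one variable x_w yields an uncountable,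
   algebraically closed, proper subfield F of L containing K, and H F is
   differentially closed: modulo nilpotents, H F{y} is an F-algebra of countable
   dimension, so the Nullstellensatz over the uncountable field F provides
   points of its spectrum, and the Taylor homomorphisms of these points are zeros
   of differential ideals. *)

Require Import Defs.
From HB Require Import structures.
From mathcomp Require Import all_boot all_order all_algebra.
From mathcomp Require Import boolp classical_sets functions cardinality.
From mathcomp Require Import finmap monalg mpoly ring.

Set Implicit Arguments.
Unset Strict Implicit.
Unset Printing Implicit Defensive.

Import GRing.Theory.
Local Open Scope classical_set_scope.
Local Open Scope ring_scope.

(** * Congruences modulo an ideal *)

Section IdealTheory.
Variables (R : comNzRingType) (J : set R).
Hypothesis idJ : ideal J.

Lemma ideal_opp x : J x -> J (- x).
Proof. by case: idJ => _ _ JM Jx; rewrite -mulN1r; apply: JM. Qed.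

Lemma ideal_sub x y : J x -> J y -> J (x - y).
Proof. by case: idJ => _ JD _ Jx Jy; apply/JD/ideal_opp. Qed.

Lemma ideal_congr x y : J (x - y) -> J y -> J x.
Proof. by case: idJ => _ JD _ Jxy Jy; rewrite -(subrK y x); apply: JD. Qed.

Lemma ideal_subX x y k : J (x - y) -> J (x ^+ k - y ^+ k).
Proof. by case: idJ => _ _ JM Jxy; rewrite subrXX mulrC; apply: JM. Qed.

Lemma ideal_sum (T : Type) (s : seq T) (P : pred T) (F : T -> R) :
  (forall i, P i -> J (F i)) -> J (\sum_(i <- s | P i) F i).
Proof. by case: idJ => J0 JD _ JF; elim/big_ind: _. Qed.

End IdealTheory.


(** * A Nullstellensatz over an uncountable algebraically closed field *)

Section Nullstellensatz.
Variables (F : fieldType) (R : comNzRingType) (s : {rmorphism F -> R}).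
Variables (e : nat -> R) (I : set R) (g : R).
Hypothesis Fclosed : forall p : {poly F}, size p != 1%N -> exists x, root p x.
Hypothesis Funcountable : ~ countable [set: F].
Hypothesis idI : ideal I.
Hypothesis gI : forall k, ~ I (g ^+ k).
Hypothesis span : forall x, exists (t : seq nat) (l : nat -> F) k,
  (x - \sum_(j <- t) s (l j) * e j) ^+ k = 0.

(** Zorn's lemma for the ideals that contain [I] and miss every power of [g]; by maximality,
    adjoining [y] brings in a power of [g]. *)
Lemma maximal_avoiding_ideal : exists J : set R, [/\ ideal J, I `<=` J,
  (forall k, ~ J (g ^+ k)) &
  (forall y, ~ J y -> exists h k, J (g ^+ k - h * y))].
Proof.
pose P (J : set R) := J = set0 \/ [/\ ideal J, I `<=` J & forall k, ~ J (g ^+ k)].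
have [|J [PJ Jmax]] := @Zorn_bigcup R P.
  move=> C CP Ctot.
  have [[X0 CX0 [y X0y]]|C0] := pselect (exists2 X, C X & X !=set0); last first.
    left; apply/seteqP; split=> x //= [X CX Xx].
    by apply: C0; exists X => //; exists x.
  have CI X x : C X -> X x -> [/\ ideal X, I `<=` X & forall k, ~ X (g ^+ k)].
    by move=> CX Xx; case: (CP _ CX) => // X_0; rewrite X_0 in Xx.
  right; split; first split.
  - by exists X0 => //; case: (CI _ _ CX0 X0y) => -[].
  - move=> x z [X CX Xx] [Z CZ Zz].
    have [XZ|ZX] := Ctot _ _ CX CZ.
      by exists Z => //; case: (CI _ _ CZ Zz) => -[_ ZD _] _ _; apply: ZD => //; apply: XZ.
    by exists X => //; case: (CI _ _ CX Xx) => -[_ XD _] _ _; apply: XD => //; apply: ZX.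
  - move=> x z [Z CZ Zz]; exists Z => //.
    by case: (CI _ _ CZ Zz) => -[_ _ ZM] _ _; apply: ZM.
  - move=> x Ix; exists X0 => //.
    by case: (CI _ _ CX0 X0y) => _ + _; apply.
  - move=> k [X CX Xk]; case: (CI _ _ CX Xk) => _ _ /(_ k); exact.
case: PJ => [J0|[idJ IJ gJ]].
  case: (Jmax I); last by right; split.
  rewrite J0; split=> // /(_ 0) H; apply: H; by case: idI.
exists J; split=> // y Jy; apply: contrapT => nex.
have [J0 JD JM] := idJ.
pose J' : set R := [set x | exists h, J (x - h * y)].
apply: (Jmax J').
  split; last first.
    move=> /(_ y) H; apply/Jy/H; exists 1; by rewrite mul1r subrr.
  by move=> x Jx; exists 0; rewrite mul0r subr0.
right; split.
- split.
  + by exists 0; rewrite mul0r subr0.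
  + move=> x z [h hP] [h' hP']; exists (h + h').
    by rewrite (_ : _ - _ = (x - h * y) + (z - h' * y)); [apply: JD | ring].
  + move=> x z [h hP]; exists (x * h).
    by rewrite (_ : _ - _ = x * (z - h * y)); [apply: JM | ring].
- by move=> x /IJ Jx; exists 0; rewrite mul0r subr0.
- by move=> k [h hP]; apply: nex; exists h, k.
Qed.

Section Avoiding.
Variable J : set R.
Hypothesis idJ : ideal J.
Hypothesis gJ : forall k, ~ J (g ^+ k).
Hypothesis Jmax : forall y, ~ J y -> exists h k, J (g ^+ k - h * y).

(** Otherwise a power of [g] is congruent to a multiple of [y], and its [k]-th power lies in [J]. *)
Lemma avoiding_nilp y k : y ^+ k = 0 -> J y.
Proof.
have [J0 _ JM] := idJ.
move=> yk; apply: contrapT => /Jmax [h [j /(ideal_subX idJ k)]].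
by rewrite exprMn yk mulr0 subr0 -exprM; apply: gJ.
Qed.

(** Over [F] the polynomial [q] splits. Modulo [J] each factor [x - s c] divides a power of [g], so
    the factors cancel one by one, at the cost of raising [k], down to a nonzero constant. *)
Lemma avoiding_split x : (forall c, ~ J (x - s c)) ->
  forall (q : {poly F}) k, q != 0 -> ~ J (g ^+ k * (map_poly s q).[x]).
Proof.
have [J0 JD JM] := idJ.
move=> xc q; have [n] := ubnP (size q); elim: n q => // n IH q qn k q0.
case: (eqVneq (size q) 1%N) => [/eqP/size_poly1P[c c0 ->]|/Fclosed[a]].
  rewrite map_polyC hornerC => /(JM (s c^-1)).
  by rewrite mulrCA -rmorphM mulVf // rmorph1 mulr1; apply: gJ.
move/factor_theorem=> [r qE].
have r0 : r != 0 by apply: contraNneq q0; rewrite qE => ->; rewrite mul0r.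
have [h [j Jh]] := Jmax (xc a).
rewrite qE rmorphM /= hornerM map_polyXsubC hornerXsubC => /(JM h) Jq.
apply: (IH r _ (k + j)%N r0).
  by move: qn; rewrite qE size_Mmonic ?monicXsubC // size_XsubC addn2.
apply: ideal_congr idJ _ _ _ Jq.
have := JM (g ^+ k * (map_poly s r).[x]) _ Jh.
set b := (map_poly s r).[x].
by congr J; rewrite exprD; ring.
Qed.

(** Inverting [g] in R/J gives a field of countable dimension over [F]. If [x] were congruent to no
    constant, it would be transcendental, and the uncountably many inverses of [x - s c] would be
    independent. Below, [h c] is such an inverse up to the power [k c] of [g]. *)
Lemma avoiding_residue x : exists c, J (x - s c).
Proof.
apply: contrapT => nex; have xc c : ~ J (x - s c) by move=> Jc; apply: nex; exists c.
have [J0 JD JM] := idJ.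
have /choice[h hP] : forall c, exists h, exists k, J (g ^+ k - h * (x - s c)).
  by move=> c; apply: Jmax.
have /choice[k {}hP] := hP.
have /choice[t tP] := fun c => span (h c).
(* Sorting the constants by exponent and list of generators gives countably many classes, so one of
   them is infinite. *)
pose fib (a : nat * seq nat) : set F := [set c | k c = a.1 /\ t c = a.2].
have [a fibinf] : exists a, infinite_set (fib a).
  apply: contrapT => nfib; apply: Funcountable.
  rewrite (_ : setT = \bigcup_(a in setT) fib a); last first.
    by apply/seteqP; split=> // c _; exists (k c, t c).
  apply: bigcup_countable => // a _; apply: finite_set_countable.
  by apply: contrapT => fa; apply: nfib; exists a.
(* One constant more than there are generators forces a linear dependence between the [h c] modulo
   [J]. *)
have [B BS] := infinite_set_fset (size a.2).+1 fibinf.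
case: a {fibinf} => k0 t0 /= in BS *.
rewrite cardfE => cardB.
pose c (i : 'I_(size t0).+1) : F := val (enum_val (widen_ord cardB i)).
have c_inj : injective c by move=> i j /val_inj/enum_val_inj/(congr1 val)/= /val_inj.
have cB i : fib (k0, t0) (c i) by apply: BS; apply: (valP (enum_val _)).
have /choice[l lP] : forall i, exists l : nat -> F,
    J (h (c i) - \sum_(j <- t0) s (l j) * e j).
  move=> i; have [_ /= <-] := cB i; have [l [j lj]] := tP (c i).
  by exists l; apply: avoiding_nilp lj.
pose A := \matrix_(i < (size t0).+1, j < size t0) l i (tnth (in_tuple t0) j).
have [u uA u0] : exists2 u : 'rV_(size t0).+1, u *m A = 0 & u != 0.
  have /rowV0Pn[u /sub_kermxP uA u0] : kermx A != 0.
    by rewrite kermx_eq0 /row_free neq_ltn (leq_ltn_trans (rank_leq_col A)).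
  by exists u.
have Jh : J (\sum_i s (u 0 i) * h (c i)).
  apply: (ideal_congr idJ (y := \sum_i s (u 0 i) * \sum_(j <- t0) s (l i j) * e j)).
    by rewrite -sumrB; apply: ideal_sum => // i _; rewrite -mulrBr; apply/JM/lP.
  rewrite (_ : \sum_i _ = 0) //.
  under eq_bigr do rewrite mulr_sumr.
  rewrite exchange_big big_tnth big1 // => j _ /=.
  under eq_bigr do rewrite mulrA -rmorphM.
  rewrite -mulr_suml -rmorph_sum.
  move/matrixP/(_ 0 j): uA; rewrite !mxE.
  by under eq_bigr do rewrite mxE; move=> ->; rewrite rmorph0 mul0r.
(* As in Lagrange interpolation, [w i] vanishes at every [c j] except [c i]; so [q] is nonzero at
   [c i] whenever [u 0 i] is. *)
pose w i := \prod_(j < (size t0).+1 | j != i) ('X - (c j)%:P) : {poly F}.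
pose q := \sum_i u 0 i *: w i.
apply: (@avoiding_split x xc q k0).
  have [i ui] : exists i, u 0 i != 0 by apply/rV0Pn.
  apply/eqP => /(congr1 (horner^~ (c i))); rewrite horner0 horner_sum.
  rewrite (bigD1 i) //= big1 ?addr0 => [/eqP|j ji].
    rewrite hornerZ mulf_eq0 (negbTE ui) /= horner_prod prodf_seq_eq0.
    by case/hasP => j _ /andP[ji]; rewrite hornerXsubC subr_eq0 (inj_eq c_inj) eq_sym (negbTE ji).
  rewrite hornerZ horner_prod (bigD1 i) ?[i == j]eq_sym //=.
  by rewrite hornerXsubC subrr mul0r mulr0.
(* Modulo [J], multiplication by [Pi] turns [h (c i)] into [g ^+ k0] times the value of [w i] at
   [x]. *)
pose Pi := \prod_j (x - s (c j)).
have wE i : (map_poly s (w i)).[x] * (x - s (c i)) = Pi.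
  rewrite /Pi (bigD1 i) //= mulrC; congr (_ * _).
  rewrite rmorph_prod horner_prod; apply: eq_bigr => j _.
  by rewrite /= map_polyXsubC hornerXsubC.
rewrite rmorph_sum horner_sum mulr_sumr.
apply: (ideal_congr idJ (y := \sum_i s (u 0 i) * h (c i) * Pi)); last first.
  by rewrite -mulr_suml mulrC; apply: JM.
rewrite -sumrB; apply: ideal_sum => // i _.
rewrite /= map_polyZ hornerZ -(wE i).
have [/= kc _] := cB i; have := hP (c i); rewrite kc.
move/(JM (s (u 0 i) * (map_poly s (w i)).[x])).
by congr J; ring.
Qed.

End Avoiding.

(** The value [ev x] is the constant congruent to [x] modulo [J], unique because a nonzero constant
    in [J] would put 1 there. *)
Lemma nullstellensatz : exists ev : {rmorphism R -> F},
  [/\ cancel s ev, forall x, I x -> ev x = 0 & ev g != 0].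
Proof.
have [J [idJ IJ gJ Jmax]] := maximal_avoiding_ideal.
have [J0 JD JM] := idJ.
have /choice[ev evP] := avoiding_residue idJ gJ Jmax.
have J_s c : J (s c) -> c = 0.
  move=> Jc; apply: contrapT => /eqP c0; apply: (gJ 0%N).
  have := JM (s c^-1) _ Jc.
  by rewrite -rmorphM mulVf // rmorph1 expr0.
have evE x c : J (x - s c) -> ev x = c.
  move=> Jxc; apply/eqP; rewrite -subr_eq0; apply/eqP/J_s.
  have := ideal_sub idJ Jxc (evP x); rewrite rmorphB.
  by congr J; ring.
have evB : zmod_morphism ev.
  move=> x y; apply: evE; have := ideal_sub idJ (evP x) (evP y).
  by congr J; rewrite rmorphB; ring.
have evM : monoid_morphism ev.
  split; first by apply: evE; rewrite rmorph1 subrr.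
  move=> x y; apply: evE.
  have := JD _ _ (JM y _ (evP x)) (JM (s (ev x)) _ (evP y)).
  by congr J; rewrite rmorphM; ring.
pose ev' : {rmorphism R -> F} := HB.pack ev
  (GRing.isZmodMorphism.Build R F ev evB)
  (GRing.isMonoidMorphism.Build R F ev evM).
exists ev'; split=> [c|x Ix|] /=.
- by apply: evE; rewrite subrr.
- by apply: evE; rewrite rmorph0 subr0; apply: IJ.
- apply: contra_notN (gJ 1%N) => /eqP ev0.
  by have := evP g; rewrite ev0 rmorph0 subr0 expr1.
Qed.

End Nullstellensatz.

(** * Evaluation of polynomials in arbitrarily many variables *)

Section PolyEval.
Variables (I : choiceType) (R S : comNzRingType).
Local Notation P := {malg R[{cmonom I}]}.

Lemma malg_poly_ind (Q : P -> Prop) :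
    (forall c, Q (malgC c)) -> (forall v, Q << ucm v >>) ->
    (forall f g, Q f -> Q g -> Q (f + g)) ->
    (forall f g, Q f -> Q g -> Q (f * g)) ->
  forall f, Q f.
Proof.
move=> QC QX QD QM; elim/malg_ind => [|c k|//]; first by have := QC 0; rewrite (monalgU0 mone).
have -> : << c *g k >> = malgC c * << k >> :> P.
  by rewrite [RHS]malg_mulUU mulr1 mul1m.
apply: (QM _ _ (QC c)); elim/cmonom_ind: k => [|v k Qk]; first exact: (QC 1).
have -> : << mmul (ucm v) k >> = << ucm v >> * << k >> :> P.
  by rewrite [RHS]malg_mulUU mulr1.
exact: (QM _ _ (QX v) Qk).
Qed.

Lemma mon_evalEw (x : I -> S) (D : {fset I}) (k : {cmonom I}) :
  (finsupp k `<=` D)%fset -> mon_eval x k = \prod_(v <- D) x v ^+ k v.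
Proof.
move=> le; rewrite /mon_eval (big_fset_incl _ le) //= => v _ vk.
by rewrite fsfun_dflt.
Qed.

Lemma mon_eval_mmorphism (x : I -> S) : mmorphism (mon_eval x).
Proof.
split=> [k1 k2|]; last by rewrite /mon_eval mdom1 big_seq_fset0.
rewrite (mon_evalEw x (D := (finsupp k1 `|` finsupp k2)%fset)); last by rewrite mdomD.
rewrite (mon_evalEw x (fsubsetUl (finsupp k1) (finsupp k2))).
rewrite (mon_evalEw x (fsubsetUr (finsupp k1) (finsupp k2))).
by rewrite -big_split /=; apply: eq_bigr => v _; rewrite mulcmE exprD.
Qed.

HB.instance Definition _ (x : I -> S) :=
  isMultiplicative.Build {cmonom I} S (mon_eval x) (mon_eval_mmorphism x).

HB.instance Definition _ (f : {rmorphism R -> S}) (x : I -> S) :=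
  GRing.RMorphism.copy (poly_eval f x) (monalg.mmap f (mon_eval x)).

Variables (f : {rmorphism R -> S}) (x : I -> S).

Lemma poly_evalC c : poly_eval f x (malgC c) = f c.
Proof. by rewrite /poly_eval monalg.mmapU mmorph1 mulr1. Qed.

Lemma poly_evalX v : poly_eval f x << ucm v >> = x v.
Proof.
transitivity (f 1 * mon_eval x (ucm v)); first exact: monalg.mmapU.
by rewrite rmorph1 mul1r /mon_eval mdomU big_seq_fset1 ucmE eqxx expr1.
Qed.

End PolyEval.

(** Evaluation at the indicator function of [v] separates [v] from the other variables. *)
Lemma malg_var_inj (I : choiceType) (R : comNzRingType) :
  injective (fun v : I => << ucm v >> : {malg R[{cmonom I}]}).
Proof.
move=> u v E; pose e w : R := (w == v)%:R.
have [g gX] : exists g : {malg R[{cmonom I}]} -> R, forall w, g << ucm w >> = e w.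
  by exists (poly_eval (idfun : {rmorphism R -> R}) e) => w; apply: poly_evalX.
have : e u = e v by apply: etrans (esym (gX u)) (etrans (congr1 g E) (gX v)).
by rewrite /e eqxx; case: eqVneq {E} => // _ /esym /eqP; rewrite oner_eq0.
Qed.

(** * Derivative operators, differential polynomials and their evaluation *)

Section DiffTheory.
Variable m : nat.

Lemma theta_0 (R : diffRingType m) a : theta a (0 : R) = 0.
Proof. by apply: (addrI (theta a 0)); rewrite -thetaD !addr0. Qed.

Lemma derX (R : diffRingType m) i (x : R) n :
  der i (x ^+ n) = (x ^+ n.-1 * der i x) *+ n.
Proof.
elim: n => [|n IH]; first by rewrite expr0 mulr0n der1.
rewrite exprS derM IH [n.+1.-1]/= mulrS mulrC; congr (_ + _).
case: n {IH} => [|n]; first by rewrite !mulr0n mulr0.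
by rewrite mulrnAr mulrA -exprS.
Qed.

Lemma theta_morph (A B : diffRingType m) (u : {rmorphism A -> B}) :
  diff_morphism u -> forall a x, u (theta a x) = theta a (u x).
Proof.
move=> uD; elim/mnm_ind => [|a i IH] x; first by rewrite !theta0.
by rewrite !thetaS IH uD.
Qed.

Lemma theta_exp_pchar (R : diffRingType m) (x : R) p a : p%:R = 0 :> R ->
  a != 0%MM -> theta a (x ^+ p) = 0.
Proof.
move=> p0; elim/mnm_ind: a => [|a i _ _]; first by rewrite eqxx.
by rewrite thetaS derX -mulr_natr p0 mulr0 theta_0.
Qed.

Lemma der_comm_add (B C : diffRingType m) (h : {rmorphism B -> C}) i f g :
    h (der i f) = der i (h f) -> h (der i g) = der i (h g) ->
  h (der i (f + g)) = der i (h (f + g)).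
Proof. by move=> Ef Eg; rewrite derD !rmorphD Ef Eg derD. Qed.

Lemma der_comm_mul (B C : diffRingType m) (h : {rmorphism B -> C}) i f g :
    h (der i f) = der i (h f) -> h (der i g) = der i (h g) ->
  h (der i (f * g)) = der i (h (f * g)).
Proof. by move=> Ef Eg; rewrite derM rmorphD !rmorphM Ef Eg derM. Qed.

End DiffTheory.

(* Locked because unification otherwise unfolds polynomials down to finitely
   supported functions and does not terminate in reasonable time. *)
HB.lock Definition diffC (m : nat) (A : diffRingType m) (n : nat) (c : A) :
  diffpoly A n := malgC c.
Canonical diffC_unlockable := Unlockable diffC.unlock.

HB.lock Definition diffX (m : nat) (A : diffRingType m) (n : nat)
  (v : 'I_n * 'X_{1..m}) : diffpoly A n := << ucm v >>.
Canonical diffX_unlockable := Unlockable diffX.unlock.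

HB.lock Definition diffpoly_eval (m : nat) (A C : diffRingType m)
    (u : {rmorphism A -> C}) (n : nat) (y : 'I_n -> C) (f : diffpoly A n) : C :=
  poly_eval u (fun v => theta v.2 (y v.1)) f.
Canonical diffpoly_eval_unlockable := Unlockable diffpoly_eval.unlock.

Section DiffPolyConst.
Variables (m : nat) (A : diffRingType m) (n : nat).
Local Notation monalgC := (@mkmalgU {cmonom ('I_n * 'X_{1..m})%type} A mone).
Local Notation diffC := (@diffC m A n).
Local Notation diffX := (@diffX m A n).

Fact diffC_zmod_morphism : zmod_morphism diffC.
Proof. by move=> c d; rewrite unlock; apply: (rmorphB monalgC). Qed.

Fact diffC_monoid_morphism : monoid_morphism diffC.
Proof.
split=> [|c d]; rewrite unlock; first exact: (rmorph1 monalgC).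
exact: (rmorphM monalgC).
Qed.

HB.instance Definition _ :=
  GRing.isZmodMorphism.Build A (diffpoly A n) diffC diffC_zmod_morphism.
HB.instance Definition _ :=
  GRing.isMonoidMorphism.Build A (diffpoly A n) diffC diffC_monoid_morphism.

Lemma diffpoly_ind (P : diffpoly A n -> Prop) :
    (forall c, P (diffC c)) -> (forall v, P (diffX v)) ->
    (forall f g, P f -> P g -> P (f + g)) ->
    (forall f g, P f -> P g -> P (f * g)) ->
  forall f, P f.
Proof. by rewrite !unlock; apply: malg_poly_ind. Qed.

Lemma diffpoly_monE : exists M : {cmonom ('I_n * 'X_{1..m})%type} -> diffpoly A n,
  forall f, f = \sum_(k <- monalg.msupp f) diffC (monalg.mcoeff k f) * M k.
Proof.
exists (fun k => << k >>) => f; apply: etrans (monalgE f) _.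
apply: eq_bigr => k _; rewrite unlock; apply: esym.
by apply: etrans (malg_mulUU _ _ _ _) _; rewrite mulr1 mul1m.
Qed.

Lemma der_diffC i c : der i (diffC c) = diffC (der i c).
Proof. rewrite unlock; exact: (poly_derC _ (@derD _ _ i)). Qed.

Lemma der_diffX i v : der i (diffX v) = diffX (v.1, (v.2 + U_(i))%MM).
Proof. rewrite unlock; exact: (poly_derX _ (@derD _ _ i) (@derM _ _ i)). Qed.

Lemma theta_diffX i a : theta a (diffX (i, 0%MM)) = diffX (i, a).
Proof.
(* The induction on [a] shifts the index of the variable, so 0 is generalized to [b]. *)
rewrite -{2}[a]add0m; move: {1 2}0%MM => b.
elim/mnm_ind: a b => [|a j IH] b; first by rewrite theta0 addm0.
by rewrite thetaS der_diffX IH /= -addmA [(U_(j) + _)%MM]addmC.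
Qed.

End DiffPolyConst.

Section DiffEval.
Variables (m : nat) (A C : diffRingType m) (u : {rmorphism A -> C}) (n : nat).
Variable y : 'I_n -> C.

Local Notation ev := (poly_eval u (fun v : 'I_n * 'X_{1..m} => theta v.2 (y v.1))).
Local Notation diffpoly_eval := (diffpoly_eval u y).

Fact diffpoly_eval_zmod_morphism : zmod_morphism diffpoly_eval.
Proof. by move=> f g; rewrite unlock; apply: (rmorphB ev). Qed.

Fact diffpoly_eval_monoid_morphism : monoid_morphism diffpoly_eval.
Proof.
split=> [|f g]; rewrite unlock; first exact: (rmorph1 ev).
exact: (rmorphM ev).
Qed.

HB.instance Definition _ := GRing.isZmodMorphism.Build (diffpoly A n) C
  diffpoly_eval diffpoly_eval_zmod_morphism.
HB.instance Definition _ := GRing.isMonoidMorphism.Build (diffpoly A n) C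
  diffpoly_eval diffpoly_eval_monoid_morphism.

Lemma diffpoly_evalC c : diffpoly_eval (diffC n c) = u c.
Proof. rewrite !unlock; exact: poly_evalC. Qed.

Lemma diffpoly_evalX v : diffpoly_eval (diffX A v) = theta v.2 (y v.1).
Proof. rewrite !unlock; exact: (poly_evalX u (fun v : 'I_n * 'X_{1..m} => theta v.2 (y v.1))). Qed.

(** Turns an algebraic equation for a single derivative of [y i] into a differential polynomial. *)
Lemma diffpoly_eval_horner (q : {poly A}) i a :
  diffpoly_eval (map_poly (@diffC m A n) q).[diffX A (i, a)] =
  (map_poly u q).[theta a (y i)].
Proof.
apply: etrans (esym (horner_map _ _ _)) _.
rewrite -map_poly_comp /= diffpoly_evalX; congr (_.[_]).
by apply: eq_map_poly => c; apply: diffpoly_evalC.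
Qed.

Lemma diffpoly_eval_der : diff_morphism u -> diff_morphism diffpoly_eval.
Proof.
move=> uD i f; elim/diffpoly_ind: f => [c|v||].
- by rewrite der_diffC !diffpoly_evalC uD.
- by rewrite der_diffX !diffpoly_evalX /= thetaS der_theta.
- exact: der_comm_add.
- exact: der_comm_mul.
Qed.

End DiffEval.

Lemma diff_evalE m (A : diffRingType m) n (y : 'I_n -> A) f :
  diff_eval y f = diffpoly_eval idfun y f.
Proof. by rewrite unlock. Qed.

(** * Free terms and constants of Hurwitz series *)

Section HurwitzTheory.
Variables (m : nat) (F : comNzRingType).
Local Notation H := (hurwitz m F).

Definition hfree (x : H) : F := hcoef x 0%MM.

Fact hfree_zmod_morphism : zmod_morphism hfree.
Proof. by []. Qed.

Fact hfree_monoid_morphism : monoid_morphism hfree.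
Proof. by split=> [|x y]; rewrite /hfree /= ?eqxx //; apply: hmul_coef0. Qed.

HB.instance Definition _ := GRing.isZmodMorphism.Build H F hfree hfree_zmod_morphism.
HB.instance Definition _ := GRing.isMonoidMorphism.Build H F hfree hfree_monoid_morphism.

Lemma hcoef_theta g (x : H) : hcoef x g = hfree (theta g x).
Proof.
elim/mnm_ind: g x => [|g i IH] x; first by rewrite theta0.
by rewrite thetaS -IH.
Qed.

Lemma hurwitz_natr_pchar p : p \in [pchar F] -> p%:R = 0 :> H.
Proof.
move=> pF; apply: hurwitzP => g; rewrite hcoef_theta.
suff -> n : theta g (n%:R : H) = theta g 1 *+ n by rewrite rmorphMn mulrn_pchar.
by elim: n => [|n IH]; rewrite ?mulr0n ?theta_0 // !mulrS thetaD IH.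
Qed.

(** A series is determined by the free terms of its derivatives; those of [x ^+ p] of positive order
    vanish in characteristic [p]. *)
Lemma hfree0_exp_pchar p (x : H) : p \in [pchar F] -> hfree x = 0 -> x ^+ p = 0.
Proof.
move=> pF x0; apply: hurwitzP => g; rewrite hcoef_theta.
have [->|g0] := eqVneq g 0%MM; last first.
  by rewrite theta_exp_pchar ?rmorph0 // hurwitz_natr_pchar.
by rewrite theta0 rmorphXn /= x0 expr0n; case/andP: pF => /prime_gt0; case: p.
Qed.

(** A section of [hfree] with values killed by every derivation. *)
Definition hconst (c : F) : H := Hurwitz (fun g => if g == 0%MM then c else 0).

Lemma der_hconst i c : der i (hconst c) = 0.
Proof. by apply: hurwitzP => g /=; rewrite -mdeg_eq0 mdegD mdeg1 addn1. Qed.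

Lemma hfree_hconst c : hfree (hconst c) = c.
Proof. by rewrite /hfree /= eqxx. Qed.

Fact hconst_zmod_morphism : zmod_morphism hconst.
Proof.
move=> c d; apply: hurwitzP => g /=.
by case: ifP => // _; rewrite subr0.
Qed.

Fact hconst_monoid_morphism : monoid_morphism hconst.
Proof.
split=> [|c d]; apply: hurwitzP => g; first by rewrite /=; case: eqP.
rewrite !hcoef_theta; elim/mnm_ind: g => [|g i _].
  by rewrite !theta0 /hfree [RHS]hmul_coef0 /= eqxx.
by rewrite !thetaS derM !der_hconst mul0r mulr0 addr0.
Qed.


End HurwitzTheory.

Lemma countable_cmonom (I : countType) : countable [set: {cmonom I}].
Proof.
apply/countable_injP.
pose f (k : {cmonom I}) := choice.pickle [seq (v, k v) | v <- finsupp k].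
exists f => k1 k2 _ _ /(pcan_inj choice.pickleK) E; apply/eqP/cmP => v.
have H (k k' : {cmonom I}) : [seq (v, k v) | v <- finsupp k] =
    [seq (v, k' v) | v <- finsupp k'] -> v \in finsupp k -> k v = k' v.
  move=> Ek vk; have : (v, k v) \in [seq (v, k' v) | v <- finsupp k'].
    by rewrite -Ek; apply: map_f.
  by case/mapP => w _ [-> ->].
case: (boolP (v \in finsupp k1)) => [/(H _ _ E)//|v1].
case: (boolP (v \in finsupp k2)) => [/(H _ _ (esym E))//|v2].
by rewrite !fsfun_dflt.
Qed.

(** * Rings identified with Hurwitz series by a Taylor homomorphism *)

Section TaylorClosed.
Variables (m : nat) (D : diffRingType m) (F : fieldType).
Variables (phi : {rmorphism D -> F}) (p : nat).
Hypothesis pF : p \in [pchar F].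
Hypothesis taylor_inj : injective (taylor phi).
Hypothesis taylor_surj : forall h, exists d, taylor phi d = h.

Lemma hfree_taylor d : hfree (taylor phi d) = phi d.
Proof. exact: taylor_free. Qed.

Lemma taylor_natr_pchar : p%:R = 0 :> D.
Proof. by apply: taylor_inj; rewrite rmorph_nat rmorph0 hurwitz_natr_pchar. Qed.

Lemma taylor_exp_pchar d : phi d = 0 -> d ^+ p = 0.
Proof.
move=> d0; apply: taylor_inj; rewrite rmorphXn rmorph0.
by apply: hfree0_exp_pchar; rewrite ?hfree_taylor.
Qed.

(** A nonzero element of [I] has a derivative with nonzero free term, which a constant [e] scales to
    1. The result is 1 up to a nilpotent, hence a unit. *)
Lemma taylor_quasifield : quasifield D.
Proof.
split.
  by exists p; [case/andP: pF => /prime_gt0 | apply: taylor_natr_pchar].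
move=> I idI; have [[d Id d0]|I0] := pselect (exists2 d, I d & d != 0); last first.
  left; apply/seteqP; split=> [d Id|_ ->]; last exact: diff_ideal0.
  by apply: contrapT => /eqP d0; apply: I0; exists d.
right; apply/seteqP; split=> // z _.
have [g dg] : exists g, phi (theta g d) != 0.
  apply: contrapT => nex; move/eqP: d0; apply; apply: taylor_inj.
  rewrite rmorph0; apply: hurwitzP => g /=; apply: contrapT => /eqP dg.
  by apply: nex; exists g.
have [e eE] := taylor_surj (hconst m (phi (theta g d))^-1).
have Ie : I (e * theta g d).
  apply: diff_idealM => //; elim/mnm_ind: g d {d0 dg eE} Id => [|g i IH] d Id.
    by rewrite theta0.
  by rewrite thetaS; apply/IH/(diff_ideal_der idI).
have E1 : phi (1 - e * theta g d) = 0.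
  rewrite rmorphB rmorph1 rmorphM -(hfree_taylor e) eE hfree_hconst.
  by rewrite mulVf // subrr.
(* With [w := e * theta g d], the element [1 - (1 - w) ^+ p] equals 1 and, as a difference of [p]-th
   powers, is a multiple of [w]. *)
have /subr0_eq E : (1 - (1 - e * theta g d) ^+ p) - 1 = 0.
  by rewrite taylor_exp_pchar // subr0 subrr.
rewrite -[z]mulr1; apply: diff_idealM => //; rewrite -E.
rewrite -{1}(expr1n D p) subrXX mulrC; apply: diff_idealM => //.
by rewrite subKr.
Qed.

Hypothesis Fclosed : forall q : {poly F}, size q != 1%N -> exists x, root q x.
Hypothesis Funcountable : ~ countable [set: F].

(** At a zero of [I], the derivatives of an [f] in the radical take values whose images in the field
    [F] are nilpotent, hence 0. Conversely, if no power of [theta a f] is in [I], some [F]-point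
    [ev] kills [I] but not [theta a f], and its Taylor lift is a zero of [I] at which [f] does not
    vanish. *)
Lemma taylor_diff_closed : diff_closed D.
Proof.
have /choice[s0 s0E] := fun c => taylor_surj (hconst m c).
have s0B : zmod_morphism s0.
  by move=> c d; apply: taylor_inj; rewrite taylor_zmod_morphism !s0E; apply: hconst_zmod_morphism.
have s0M : monoid_morphism s0.
  split=> [|c d]; apply: taylor_inj; last first.
    by rewrite (taylor_monoid_morphism phi).2 !s0E; apply: (hconst_monoid_morphism m F).2.
  by rewrite s0E (taylor_monoid_morphism phi).1; apply: (hconst_monoid_morphism m F).1.
pose s : {rmorphism F -> D} := HB.pack s0
  (GRing.isZmodMorphism.Build F D s0 s0B)
  (GRing.isMonoidMorphism.Build F D s0 s0M).
have phis c : phi (s c) = c by rewrite -hfree_taylor s0E hfree_hconst.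
move=> n I idI; apply/seteqP; split=> f.
  move=> rf y zy; apply: taylor_inj; rewrite rmorph0; apply: hurwitzP => g.
  have [k Ik] := rf g.
  have /(congr1 phi) := zy _ Ik.
  have thE h : diff_eval y (theta g h) = theta g (diff_eval y h).
    rewrite !diff_evalE; apply: (theta_morph (u := diffpoly_eval idfun y)).
    exact: diffpoly_eval_der.
  have evX h : diff_eval y (h ^+ k) = diff_eval y h ^+ k.
    by rewrite !diff_evalE; apply: (rmorphXn (diffpoly_eval idfun y)).
  by rewrite evX thE rmorphXn rmorph0 => /eqP; rewrite expf_eq0 => /andP[_ /eqP].
move=> vf a; apply: contrapT => nex.
have [e eP] : exists e : nat -> diffpoly D n, forall x, exists (t : seq nat) (l : nat -> F) k,
    (x - \sum_(j <- t) diffC n (s (l j)) * e j) ^+ k = 0.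
  have /countable_injP[r r_inj] := countable_cmonom ('I_n * 'X_{1..m})%type.
  (* [r'] inverts the numbering [r] of the monomials, with default [mone] off its range. *)
  have /choice[r' r'K] j : exists k, forall k', r k' = j -> k' = k.
    have [[k rk]|nk] := pselect (exists k, r k = j); last first.
      by exists mone => k rk; case: nk; exists k.
    by exists k => k' rk'; apply: r_inj; rewrite ?in_setT // rk.
  have [M ME] := diffpoly_monE D n.
  have pchar_poly : p \in [pchar (diffpoly D n)].
    rewrite inE (pcharf_prime pF) /= -(rmorph_nat (@diffC m D n)).
    by rewrite taylor_natr_pchar rmorph0.
  exists (fun j => M (r' j)) => x.
  (* Applying [s \o phi] to a coefficient changes it by an element with zero [p]-th power; Frobenius
     being additive, the exponent [p] serves for the whole sum. *)
  exists [seq r k | k <- monalg.msupp x], (fun j => phi (monalg.mcoeff (r' j) x)), p.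
  rewrite big_map {1}[x]ME -sumrB -(pFrobenius_autE pchar_poly) rmorph_sum.
  rewrite big1 // => k _; apply: etrans (pFrobenius_autE _ _) _.
  rewrite -(r'K _ k erefl) -mulrBl exprMn -(rmorphB (@diffC m D n)) -(rmorphXn (@diffC m D n)).
  rewrite taylor_exp_pchar ?(rmorph0 (@diffC m D n)) ?mul0r //.
  by rewrite rmorphB phis subrr.
have [||ev [evs evI evf]] := @nullstellensatz F (diffpoly D n)
    (diffC n \o s) e I (theta a f) Fclosed Funcountable _ _ eP.
- by split; [exact: (diff_ideal0 idI) | exact: (diff_idealD idI) | exact: (diff_idealM idI)].
- by move=> k Ik; apply: nex; exists k.
(* [d] and [s (phi d)] differ by a nilpotent, which maps to 0 in [F]. *)
have evC d : ev (diffC n d) = phi d.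
  have dp : (d - s (phi d)) ^+ p = 0.
    by apply: taylor_exp_pchar; rewrite rmorphB phis subrr.
  have : ev (diffC n d - diffC n (s (phi d))) ^+ p = 0.
    rewrite -rmorphXn -(rmorphB (@diffC m D n)) -(rmorphXn (@diffC m D n)) dp.
    by rewrite (rmorph0 (@diffC m D n)) rmorph0.
  move/eqP; rewrite expf_eq0 => /andP[_]; rewrite rmorphB subr_eq0 => /eqP->.
  exact: evs.
pose T := taylor ev.
have /choice[y yE] i : exists z, taylor phi z = T (diffX D (i, 0%MM)).
  exact: taylor_surj.
(* Under [taylor phi], evaluation at [y] becomes [T]: both are ring morphisms that agree on
   coefficients and variables. *)
have TE h : taylor phi (diff_eval y h) = T h.
  rewrite diff_evalE; elim/diffpoly_ind: h => [c|[i b]|h1 h2 E1 E2|h1 h2 E1 E2].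
  - rewrite diffpoly_evalC; apply: hurwitzP => g /=.
    by rewrite -(theta_morph (u := diffC n)) ?evC // => i z; rewrite der_diffC.
  - rewrite diffpoly_evalX /= -(theta_diffX D i b).
    rewrite (theta_morph (u := taylor phi)); last exact: taylor_der.
    rewrite /T (theta_morph (u := taylor ev)); last exact: taylor_der.
    by congr (theta b _); apply: yE.
  - rewrite (rmorphD (diffpoly_eval idfun y)) (rmorphD (taylor phi)).
    by rewrite [RHS](rmorphD (taylor ev)); apply: (congr2 _ E1 E2).
  - rewrite (rmorphM (diffpoly_eval idfun y)) (rmorphM (taylor phi)).
    by rewrite [RHS](rmorphM (taylor ev)); apply: (congr2 _ E1 E2).
have zy : zero_set I y.
  move=> h Ih; apply: taylor_inj; rewrite TE rmorph0; apply: hurwitzP => g /=.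
  apply: evI; elim/mnm_ind: g h Ih => [|g i IH] h Ih; first by rewrite theta0.
  by rewrite thetaS; apply/IH/(diff_ideal_der idI).
move/eqP: evf; apply.
have := TE f; rewrite vf // rmorph0 => /(congr1 (fun x => hcoef x a)) /= <-.
by [].
Qed.
End TaylorClosed.

(** * Differentially closed subrings over whose free terms the field is algebraic *)

Lemma diff_closed_subring_full m (L : fieldType) (p : nat)
    (D : set (hurwitz m L)) (hD : diff_subring D) :
    p \in [pchar L] -> diff_closed (subDiffRing hD) ->
    (forall z : L, exists q : {poly L}, [/\ q != 0, root q z &
       forall i, exists2 d, D d & hfree d = q`_i]) ->
  D = setT.
Proof.
move=> pL Dclosed Lalg; apply/seteqP; split=> // h _.
pose A := subDiffRing hD.
pose u : {rmorphism A -> hurwitz m L} := \val.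
have uD : diff_morphism u by [].
have memD (x : A) : D (u x) by case: x => x /= /asboolP.
pose phi : {rmorphism A -> L} := @hfree m L \o u.
pose E := diffpoly_eval u (fun _ : 'I_1 => h).
have ED : diff_morphism E by apply: diffpoly_eval_der.
have E0 : E 0 = 0 := rmorph0 (diffpoly_eval u _).
have E1 : E 1 = 1 := rmorph1 (diffpoly_eval u _).
have Eadd f g : E (f + g) = E f + E g := rmorphD (diffpoly_eval u _) f g.
have Emul f g : E (f * g) = E f * E g := rmorphM (diffpoly_eval u _) f g.
have Eexp f k : E (f ^+ k) = E f ^+ k := rmorphXn (diffpoly_eval u _) k f.
(* The kernel of evaluation at [h] omits 1, so closedness gives it a zero in [D]. *)
pose a : set (diffpoly A 1) := [set f | E f = 0].
have ida : diff_ideal a.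
  rewrite /a; split=> /= [|f g Ef Eg|f g Eg|i f Ef].
  - exact: E0.
  - by rewrite Eadd Ef Eg addr0.
  - by rewrite Emul Eg mulr0.
  - by rewrite ED Ef der0.
have [y ya] : exists y, zero_set a y.
  apply: contrapT => nex.
  have /(_ 0%MM)[k] : drad a 1.
    by rewrite Dclosed // => y ya; case: nex; exists y.
  by rewrite theta0 expr1n /a /= E1 => /eqP; rewrite oner_eq0.
pose d := y ord0.
(* At [h], [f] has free term 0 and is only nilpotent; hence [f ^+ p], rather than [f], is put into
   [a]. *)
have key g (q : {poly A}) :
    root (map_poly phi q) (hcoef h g) -> root (map_poly phi q) (phi (theta g d)).
  move=> qh; pose f := (map_poly (@diffC m A 1) q).[diffX A (ord0, g)].
  have Ef : E f = (map_poly u q).[theta g h] by apply: diffpoly_eval_horner.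
  have af : a (f ^+ p).
    rewrite /a /= Eexp; apply: hfree0_exp_pchar => //.
    rewrite Ef; apply: etrans (esym (horner_map (@hfree m L) _ _)) _.
    by rewrite -map_poly_comp /= -hcoef_theta; apply/rootP.
  have fy : diff_eval y f = q.[theta g d].
    rewrite diff_evalE; apply: etrans (diffpoly_eval_horner _ _ _ _ _) _.
    by rewrite map_poly_id.
  have fpy : diff_eval y (f ^+ p) = diff_eval y f ^+ p.
    by rewrite !diff_evalE; apply: (rmorphXn (diffpoly_eval idfun y)).
  have /(congr1 phi) : diff_eval y (f ^+ p) = 0 by apply: ya.
  rewrite fpy fy rmorphXn rmorph0 => /eqP; rewrite expf_eq0 => /andP[_].
  by rewrite -horner_map.
(* By [key], [phi (theta g d)] is a root too. Splitting it off either identifies the two roots or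
   leaves a smaller polynomial that vanishes at [hcoef h g]. *)
have phi_root g n (r : {poly A}) : (size r <= n)%N -> map_poly phi r != 0 ->
    root (map_poly phi r) (hcoef h g) -> hcoef h g = phi (theta g d).
  elim: n r => [|n IH] r sz r0 rz.
    by move: r0; rewrite (size_poly_leq0P _ sz) rmorph0 eqxx.
  (* Only the image under [phi] of [r.[theta g d]] vanishes, so this value is subtracted before
     factoring over [A]. *)
  have /factor_theorem[r1 r1E] : root (r - (r.[theta g d])%:P) (theta g d).
    by rewrite /root hornerD hornerN hornerC subrr.
  have rb : phi r.[theta g d] = 0.
    by move/key/rootP: rz; rewrite horner_map.
  have rE : map_poly phi r = map_poly phi r1 * ('X - (phi (theta g d))%:P).
    rewrite -map_polyXsubC -rmorphM -r1E rmorphB -[LHS]subr0; congr (_ - _).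
    by apply: esym; apply: etrans (map_polyC phi _) (etrans (congr1 polyC rb) (polyC0 _)).
  move: (rz); rewrite rE rootM root_XsubC => /orP[r1z|/eqP//].
  have r10 : map_poly phi r1 != 0.
    by apply: contraNneq r0; rewrite rE => ->; rewrite mul0r.
  apply: (IH r1) => //; rewrite -ltnS; apply: leq_trans sz.
  have r1n : r1 != 0 by apply: contraNneq r10 => ->; rewrite rmorph0.
  have : size (r1 * ('X - (theta g d)%:P)) = (size r1).+1.
    by rewrite size_Mmonic ?monicXsubC // size_XsubC addn2.
  rewrite -r1E => <-; apply: leq_trans (size_polyD _ _) _.
  rewrite geq_max leqnn size_opp /=; apply: leq_trans (size_polyC_leq1 _) _.
  by rewrite size_poly_gt0; apply: contraNneq r0 => ->; rewrite rmorph0.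
have eqd g : hcoef h g = phi (theta g d).
  have [q [q0 qz qD]] := Lalg (hcoef h g).
  have /choice[l lE] i : exists x : A, phi x = q`_i.
    have [x Dx <-] := qD i.
    by exists (SubDiffRing (asboolT Dx : x \in sub_pred hD)).
  have mapE : map_poly phi (\poly_(i < size q) l i) = q.
    apply/polyP => i; rewrite coef_map coef_poly.
    by case: ltnP => [_|/(nth_default 0)->]; [apply: lE | apply: (rmorph0 phi)].
  by apply: (phi_root g _ (\poly_(i < size q) l i) (leqnn _)); rewrite mapE.
suff -> : h = u d by [].
by apply: hurwitzP => g; rewrite eqd hcoef_theta -(theta_morph uD).
Qed.

(** * Algebraically closed subfields and a proper one missing a variable *)

Section SubField.
Variables (E : fieldType) (S : {pred E}) (hS : divring_closed S).

(** The closure proof is an argument so that the subfield structure can be attached to the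
    predicate. *)
Definition subfield_pred of divring_closed S : {pred E} := S.

HB.instance Definition _ :=
  GRing.isDivringClosed.Build E (subfield_pred hS) hS.

Record subFieldType : predArgType :=
  SubField { subfield_val : E; _ : subfield_val \in subfield_pred hS }.

HB.instance Definition _ := [isSub for subfield_val].
HB.instance Definition _ := [Choice of subFieldType by <:].
HB.instance Definition _ := [SubChoice_isSubIntegralDomain of subFieldType by <:].
HB.instance Definition _ := [SubIntegralDomain_isSubField of subFieldType by <:].

End SubField.

Lemma algebraic_divring_closed (F E : fieldType) (f : {rmorphism F -> E}) :
  divring_closed (fun z => `[< algebraicOver f z >]).
Proof.
split=> [|x y /asboolP fx /asboolP fy|x y /asboolP fx /asboolP fy]; apply/asboolP.
- exact: algebraic1.
- exact: algebraic_sub.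
- exact: algebraic_div.
Qed.

(** A root in [E] of a nonzero polynomial with coefficients algebraic over [F] is itself algebraic
    over [F]. *)
Lemma algebraic_closed_subfield (F : fieldType) (E : closedFieldType)
    (f : {rmorphism F -> E}) (q : {poly subFieldType (algebraic_divring_closed f)}) :
  size q != 1%N -> exists x, root q x.
Proof.
pose v : {rmorphism subFieldType (algebraic_divring_closed f) -> E} := \val.
move=> q1; have [q0|q0] := eqVneq q 0; first by exists 0; rewrite q0 root0.
have /closed_rootP[z qz] : size (map_poly v q) != 1%N by rewrite size_map_poly.
have fz : algebraicOver f z.
  apply/integral_algebraic; apply: integral_root qz _.
    by rewrite map_poly_eq0.
  move=> _ /(nthP 0)[i _ <-]; rewrite coef_map /=.
  by apply/integral_algebraic; case: (q`_i) => /= y /asboolP.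
exists (SubField (asboolT fz : z \in subfield_pred (algebraic_divring_closed f))).
by rewrite -(fmorph_root v).
Qed.

(* [tau u] stands for the substitution X_w0 := X_u. An algebraic relation for
   X_w0 over the fixed ring of all these substitutions is satisfied by every
   X_u, of which there are infinitely many. *)
Section Retraction.
Variables (W : choiceType) (P : comNzRingType) (M : fieldType).
Variables (ev : {rmorphism P -> M}) (X : W -> P) (w0 : W).
Variable tau : W -> {rmorphism P -> P}.
Hypothesis ev_inj : injective ev.
Hypothesis X_inj : injective X.
Hypothesis tauX : forall u, tau u (X w0) = X u.

(** In the application these fractions include [K] and every variable except [x w0]. *)
Definition fixed_frac (z : M) : Prop := exists f g,
  [/\ forall u, tau u f = f, forall u, tau u g = g, ev g != 0 & z = ev f / ev g].

Lemma fixed_frac_divring_closed : divring_closed (fun z => `[< fixed_frac z >]).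
Proof.
split=> [|x y|x y].
- apply/asboolP; exists 1, 1.
  by split=> [u|u||]; rewrite ?rmorph1 ?oner_eq0 // divr1.
- move=> /asboolP[f [g [Tf Tg g0 ->]]] /asboolP[f' [g' [Tf' Tg' g0' ->]]].
  apply/asboolP; exists (f * g' - f' * g), (g * g').
  split=> [u|u||]; rewrite ?rmorphB ?rmorphM ?Tf ?Tg ?Tf' ?Tg' ?mulf_neq0 //.
  by field; rewrite g0 g0'.
- move=> /asboolP[f [g [Tf Tg g0 ->]]] /asboolP[f' [g' [Tf' Tg' g0' ->]]].
  apply/asboolP; have [f0|f0] := eqVneq (ev f') 0.
    exists 0, 1; split=> [u|u||]; rewrite ?rmorph0 ?rmorph1 ?oner_eq0 //.
    by rewrite f0 !mul0r invr0 mulr0.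
  exists (f * g'), (g * f').
  split=> [u|u||]; rewrite ?rmorphM ?Tf ?Tg ?Tf' ?Tg' ?mulf_neq0 //.
  by field; rewrite g0 g0' f0.
Qed.

Lemma fixed_frac_fixed f : (forall u, tau u f = f) -> fixed_frac (ev f).
Proof.
move=> Tf; exists f, 1; split=> // [u||]; rewrite rmorph1 ?oner_eq0 //.
by rewrite divr1.
Qed.

Lemma fixed_frac_common_denominator (z : nat -> M) n :
    (forall i, fixed_frac (z i)) -> exists g (f : nat -> P),
  [/\ ev g != 0, forall u i, tau u (f i) = f i, forall u, tau u g = g &
      forall i, (i < n)%N -> z i * ev g = ev (f i)].
Proof.
move=> zP; elim: n => [|n [g [f [g0 Tf Tg zE]]]].
  exists 1, (fun=> 0).
  by split=> [|u _|u|//]; rewrite ?rmorph1 ?rmorph0 ?oner_eq0.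
have [a [b [Ta Tb b0 znE]]] := zP n.
exists (g * b), (fun i => if i == n then a * g else f i * b); split=> [|u i|u|i].
- by rewrite rmorphM mulf_neq0.
- by case: ifP; rewrite rmorphM ?Ta ?Tg ?Tb ?Tf.
- by rewrite rmorphM Tg Tb.
rewrite ltnS leq_eqVlt; case: eqVneq => [-> _|_ /= /zE E].
  by rewrite !rmorphM znE; field; rewrite b0.
by rewrite !rmorphM -E mulrA.
Qed.

Hypothesis W_infinite : infinite_set [set: W].

Lemma fixed_frac_transcendental (p : {poly M}) :
  p != 0 -> (forall i, fixed_frac p`_i) -> ~~ root p (ev (X w0)).
Proof.
move=> p0 pS; apply/negP => /rootP pX0.
have [g [f [g0 Tf Tg pE]]] := fixed_frac_common_denominator (size p) pS.
have hE u : ev (\sum_(i < size p) f i * X u ^+ i) = ev g * p.[ev (X u)].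
  rewrite rmorph_sum horner_coef mulr_sumr; apply: eq_bigr => i _.
  by rewrite /= rmorphM rmorphXn -pE //; ring.
(* Injectivity of [ev] brings the relation back to [P], where the substitutions act. *)
have h0 : \sum_(i < size p) f i * X w0 ^+ i = 0.
  by apply: ev_inj; rewrite hE pX0 mulr0 rmorph0.
have pX u : root p (ev (X u)).
  apply/rootP/eqP; rewrite -(mulrI_eq0 _ (lregP g0)) -hE.
  suff -> : \sum_(i < size p) f i * X u ^+ i = 0 by rewrite rmorph0.
  move/(congr1 (tau u)): h0; rewrite rmorph0 rmorph_sum => h0; rewrite -[RHS]h0.
  by apply: eq_bigr => i _; rewrite /= rmorphM rmorphXn Tf tauX.
have [B _ sB] := infinite_set_fset (size p) W_infinite.
have all_roots : all (root p) [seq ev (X u) | u <- B].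
  by apply/allP => _ /mapP[u _ ->].
have := max_poly_roots p0 all_roots.
rewrite size_map ltnNge sB map_inj_uniq ?fset_uniq => [/(_ isT)//|u v].
by move/ev_inj/X_inj.
Qed.

End Retraction.

(** [F] is the algebraic closure, inside [L], of the fixed fractions. The variables other than
    [x w0] make it uncountable, and the transcendence of [x w0] keeps [j (x w0)] out of it. *)
Lemma proper_closed_subfield (K M : fieldType) (L : closedFieldType)
    (i : {rmorphism K -> M}) (W : choiceType) (x : W -> M)
    (j : {rmorphism M -> L}) :
    rational_function_field i x -> ~ countable [set: W] ->
  exists (F : fieldType) (f : {rmorphism F -> L}),
    [/\ forall q : {poly F}, size q != 1%N -> exists z, root q z,
        ~ countable [set: F], forall z, exists c, f c = j (i z) &
        exists t, forall c, f c <> t].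
Proof.
move=> [poly_eval_inj _] Wunc.
have [w0 _] : exists w0 : W, True.
  apply: contrapT => nW; apply: Wunc; apply/countable_injP.
  by exists (fun=> 0%N) => w; case: nW; exists w.
have Winf : infinite_set [set: W] by move=> /finite_set_countable.
pose P : comNzRingType := {malg K[{cmonom W}]}.
pose ev : {rmorphism P -> M} := poly_eval i x.
pose X (w : W) : P := << ucm w >>.
pose cst : {rmorphism K -> P} := @mkmalgU {cmonom W} K mone.
pose tau (u : W) : {rmorphism P -> P} :=
  poly_eval cst (fun v => if v == w0 then X u else X v).
have ev_inj : injective ev := poly_eval_inj.
have evX w : ev (X w) = x w by apply: poly_evalX.
have evC c : ev (cst c) = i c by apply: poly_evalC.
have tauX0 u : tau u (X w0) = X u.
  by apply: etrans (poly_evalX _ _ _) _; rewrite eqxx.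
have tauX u w : w != w0 -> tau u (X w) = X w.
  by move=> ww0; apply: etrans (poly_evalX _ _ _) _; rewrite (negbTE ww0).
have tauC u c : tau u (cst c) = cst c by apply: poly_evalC.
have X_inj : injective X := @malg_var_inj W K.
(* From here on the polynomial ring is known only through these properties. *)
move: P ev X cst tau ev_inj evX evC tauX0 tauX tauC X_inj.
move=> P ev X cst tau ev_inj evX evC tauX0 tauX tauC X_inj.
pose hA := fixed_frac_divring_closed ev tau.
pose v : {rmorphism subFieldType hA -> M} := \val.
pose hF := algebraic_divring_closed (j \o v).
have jF z : fixed_frac ev tau z -> exists c : subFieldType hF, \val c = j z.
  move=> Sz.
  have alg : algebraicOver (j \o v) (j z).
    pose z' := SubField (asboolT Sz : z \in subfield_pred hA).
    exact: (algebraic_id (j \o v) z').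
  by exists (SubField (asboolT alg : j z \in subfield_pred hF)).
exists (subFieldType hF), \val; split.
- exact: algebraic_closed_subfield.
- move=> /countable_injP[r r_inj]; apply: Wunc; apply/countable_injP.
  have /choice[c cE] w : exists c : subFieldType hF, w != w0 -> \val c = j (x w).
    have [->|ww0] := eqVneq w w0; first by exists 0.
    have [|c cE] := jF (x w); last by exists c.
    by rewrite -evX; apply: fixed_frac_fixed => u; apply: tauX.
  (* The value 0 is reserved for [w0], which has no chosen representative in [F]. *)
  exists (fun w => if w == w0 then 0%N else (r (c w)).+1) => w w' _ _.
  case: eqVneq => [->|ww0]; case: eqVneq => [->//|ww0'] // [/r_inj E].
  apply/X_inj/ev_inj; rewrite !evX; apply: (fmorph_inj j).
  by rewrite -!cE // E ?in_setT.
- move=> z; apply: jF; rewrite -evC; apply: fixed_frac_fixed => u; exact: tauC.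
exists (j (x w0)) => -[t /= /asboolP algt] tE; rewrite tE in algt.
case: algt => q q0; rewrite (map_poly_comp j v) fmorph_root => qx.
apply/negP: qx; rewrite -evX.
apply: (fixed_frac_transcendental ev_inj X_inj tauX0 Winf).
  by rewrite (map_poly_eq0 v).
by move=> k; rewrite coef_map; case: (q`_k) => z /= /asboolP.
Qed.

(** * Hurwitz series with coefficients in a subfield *)

Section HurwitzSub.
Variables (m : nat) (F L : fieldType) (f : {rmorphism F -> L}).

Definition hurwitz_over : set (hurwitz m L) :=
  [set h | forall g, exists c, hcoef h g = f c].

Lemma hurwitz_over_diff_subring : diff_subring hurwitz_over.
Proof.
split.
- by move=> g; exists (g == 0%MM)%:R; rewrite rmorph_nat.
- move=> h k Dh Dk g; have [[c cE] [d dE]] := (Dh g, Dk g).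
  by exists (c - d); rewrite rmorphB -cE -dE.
- move=> h k /choice[c cE] /choice[d dE] g.
  exists (hcoef ((Hurwitz c : hurwitz m F) * Hurwitz d) g).
  rewrite /= rmorph_sum; apply: eq_bigr => a _.
  by rewrite !rmorphM rmorph_nat cE dE.
- by move=> i h Dh g; apply: Dh.
Qed.

(** [phi] is the free term pulled back along [f]. The coefficients of [taylor phi a], pushed forward
    by [f], are those of [a], so the subring is a copy of [hurwitz m F]. *)
Lemma hurwitz_over_taylor :
  exists phi : {rmorphism subDiffRing hurwitz_over_diff_subring -> F},
  injective (taylor phi) /\ forall h, exists d, taylor phi d = h.
Proof.
pose A := subDiffRing hurwitz_over_diff_subring.
pose u : {rmorphism A -> hurwitz m L} := \val.
have uD : diff_morphism u by [].
have /choice[phi0 phi0E] (a : A) : exists c, f c = hfree (u a).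
  by case: a => h /= /asboolP /(_ 0%MM) [c]; exists c.
have phi0B : zmod_morphism phi0.
  by move=> a b; apply: (fmorph_inj f); rewrite rmorphB !phi0E.
have phi0M : monoid_morphism phi0.
  split=> [|a b]; apply: (fmorph_inj f).
    by rewrite phi0E !rmorph1.
  by rewrite rmorphM !phi0E !rmorphM.
pose phi : {rmorphism A -> F} := HB.pack phi0
  (GRing.isZmodMorphism.Build A F phi0 phi0B)
  (GRing.isMonoidMorphism.Build A F phi0 phi0M).
have phiE a g : f (hcoef (taylor phi a) g) = hcoef (u a) g.
  by rewrite /= phi0E hcoef_theta -(theta_morph uD).
exists phi; split=> [a b ab|h].
  by apply: val_inj; apply: hurwitzP => g; rewrite -!phiE ab.
have Dh : hurwitz_over (Hurwitz (fun g => f (hcoef h g))).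
  by move=> g; exists (hcoef h g).
exists (SubDiffRing (asboolT Dh : _ \in sub_pred hurwitz_over_diff_subring)).
by apply: hurwitzP => g; apply: (fmorph_inj f); rewrite phiE.
Qed.

End HurwitzSub.

(** * Minimality of the differential closure *)

Theorem theorem14 (m : nat) (m_gt0 : (0 < m)%N) (Q : diffRingType m)
    (K : fieldType) (pi : {rmorphism Q -> K})
    (L : closedFieldType) (iota : {rmorphism K -> L}) :
  quasifield Q -> residue_field pi -> closure_field iota ->
  (minimal_over (range (closure_embedding pi iota))
     <-> ~ countable [set: K]%classic).
Proof.
move=> [[n n_gt0 nQ] _] [_ pi_surj] [Kunc_closure Kcount_closure].
have [p pL] : exists p, p \in [pchar L].
  apply: (natf0_pchar n_gt0); apply/eqP.
  by rewrite -(rmorph_nat (iota \o pi)) nQ rmorph0.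
split=> [min Kcount|Kunc [D [hD [_ Dclosed QD [_ DT]]]]].
  (* For countable [K], the series over the proper subfield [F] contradict minimality; the constant
     series [t] is not among them. *)
  have [W [le [M [i [x [j [[_ Wunc _] rat _ iotaE]]]]]]] := Kcount_closure Kcount.
  have [F [f [Fclosed Func KF [t tF]]]] := proper_closed_subfield j rat Wunc.
  have pF : p \in [pchar F] by rewrite -(fmorph_pchar f).
  have [phi [phi_inj phi_surj]] := hurwitz_over_taylor m f.
  apply: min; exists (hurwitz_over f), (hurwitz_over_diff_subring m f); split.
  - exact: taylor_quasifield pF phi_inj phi_surj.
  - exact: taylor_diff_closed pF phi_inj phi_surj Fclosed Func.
  - move=> _ [q _ <-] g; have [c cE] := KF (pi (theta g q)).
    by exists c; rewrite cE -iotaE.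
  - split=> // /(_ (hconst m t) I) /(_ 0%MM) [c].
    by rewrite -[hcoef _ _]/(hfree _) hfree_hconst => /esym /tF.
(* For uncountable [K], each [z] is algebraic over [K], and [K] consists of free terms of elements
   of [D] because [D] contains the image of [Q]. *)
apply: DT; rewrite (diff_closed_subring_full pL Dclosed) // => z.
have [q q0 qz] := Kunc_closure Kunc z.
exists (map_poly iota q); split=> [||k]; rewrite ?map_poly_eq0 //.
have [y yE] := pi_surj q`_k.
exists (closure_embedding pi iota y); first by apply: QD; exists y.
by rewrite coef_map -yE; apply: taylor_free.
Qed.
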